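(* For any fixed $k \in \mathbb{N}$, under the measures $\mathbb{P}_{n,k}$, $$\frac{I-\mathbb{E}_{n,k}(I)}{\sqrt{\mathrm{Var}_{n,k}(I)}} \longrightarrow Z \quad\text{in distribution, as } n\to\infty,$$ where $Z$ is a standard normal random variable. Equivalently, $$\frac{I-a_k\, n^2}{\sqrt{b_k}\, n^{3/2}} \longrightarrow Z \quad\text{in distribution, as } n\to\infty,$$ where $a_k=\frac{1}{2(k+1)}$ and $b_k=\frac{k}{3(k+1)^2(k+2)}$.
   Context: $\mathbb{N}=\{1,2,\dots\}$. For $k,n\in\mathbb{N}$, the $k$-card-minimum ($k$CM) procedure generates a random permutation of $\{1,\dots,n\}$ as follows. Let $D_1=\{1,\dots,n\}$. For $t=1,\dots,n$: given the past, $C_{t,1},\dots,C_{t,k}$ are i.i.d. uniform samples from $D_t$; $C_t=\min\{C_{t,1},\dots,C_{t,k}\}$; and $D_{t+1}=D_t\setminus\{C_t\}$. The resulting permutation is $\sigma=(C_1,\dots,C_n)$. $\mathbb{P}_{n,k}$ denotes the probability measure of this procedure with parameters $n,k$, and $\mathbb{E}_{n,k}$, $\mathrm{Var}_{n,k}$ denote expectation and variance under it. $I=I(\sigma)=|\{i<j:\sigma(i)>\sigma(j)\}|$ is the number of inversions of $\sigma$. *)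

(* Defs.v *)
From HB Require Import structures.
From mathcomp Require Import all_boot all_order all_algebra.
From mathcomp Require Import all_classical all_reals all_analysis.

Set Implicit Arguments.
Unset Strict Implicit.
Unset Printing Implicit Defensive.

Import Order.TTheory GRing.Theory Num.Theory.
Import numFieldNormedType.Exports.

Local Open Scope classical_set_scope.
Local Open Scope ring_scope.

Definition inversions (n : nat) (s : 'I_n -> nat) : nat :=
  #|[set p : 'I_n * 'I_n | (p.1 < p.2)%N && (s p.2 < s p.1)%N]%SET|.

(* Cards and times are numbered from 0: [c t i] is the sample C_{t+1,i+1},
   minus 1. The shift does not affect the number of inversions. *)
Definition draws (n k : nat) : Type := {ffun 'I_n -> {ffun 'I_k -> 'I_n}}.

HB.instance Definition _ (n k : nat) := Finite.on (draws n k).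

Lemma draws_inhabited (n k : nat) : draws n k.
Proof.
by case: n => [|n]; apply: finfun => t; [case: t | apply: finfun => _; exact: ord0].
Qed.

HB.instance Definition _ (n k : nat) :=
  isPointed.Build (draws n k) (draws_inhabited n k).

HB.instance Definition _ (n k : nat) :=
  @isMeasurable.Build default_measure_display (draws n k)
    discrete_measurable discrete_measurable0
    discrete_measurableC discrete_measurableU.

Section procedure.
Context {n k : nat}.
Implicit Types (c : draws n k) (t : 'I_n).

(* The minimum C_t; the default value [n] of the iterated minimum is larger
   than every card, hence irrelevant as soon as 0 < k. *)
Definition kcm_sigma c t : nat := \big[minn/n]_(i < k) (c t i : nat).

(* D_t, as the full deck deprived of the C_s with s < t; see [kcm_deck0] and
   [kcm_deckS] for the recursive description. *)
Definition kcm_deck c (t : nat) : {set 'I_n} :=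
  [set j : 'I_n | [forall s : 'I_n, (s < t)%N ==> (kcm_sigma c s != j)]]%SET.

(* The joint law of all the samples, by the chain rule: given the rows s < t,
   the entries of row t are independent and uniform on D_t. *)
Definition kcm_pmf (R : realType) c : R :=
  \prod_(t < n) \prod_(i < k)
    ((c t i \in kcm_deck c t)%:R / #|kcm_deck c t|%:R).

Definition kcm_inv (R : realType) c : R := (inversions (kcm_sigma c))%:R.

Lemma kcm_deck0 c : kcm_deck c 0 = [set: 'I_n]%SET.
Proof. by apply/setP => j; rewrite !inE; apply/forallP => s. Qed.

Lemma kcm_deckS c t :
  kcm_deck c t.+1 = (kcm_deck c t :\: [set j : 'I_n | kcm_sigma c t == j])%SET.
Proof.
apply/setP => j; rewrite !inE; apply/forallP/andP => [h|[ht /forallP h] s].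
  split; first by have := h t; rewrite ltnSn.
  apply/forallP => s; apply/implyP => st.
  by have /implyP := h s; apply; exact: ltnW.
apply/implyP; rewrite ltnS leq_eqVlt => /orP[/eqP/val_inj -> //|st].
by have /implyP := h s; apply.
Qed.

End procedure.

Section total_mass.
Context {n k : nat} {R : realType}.
Implicit Types c : draws n k.

Lemma card_kcm_deck_gt0 c (t : 'I_n) : (0 < #|kcm_deck c t|)%N.
Proof.
suff H m : (m <= n)%N -> (n <= #|kcm_deck c m| + m)%N.
  have := H t (ltnW (ltn_ord t)); rewrite lt0n.
  by case: eqP => // ->; rewrite add0n leqNgt ltn_ord.
elim: m => [_|m IH mn]; first by rewrite kcm_deck0 cardsT card_ord addn0.
have := IH (ltnW mn).
rewrite (kcm_deckS c (Ordinal mn)) /= => /leq_trans; apply.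
rewrite -(cardsID [set j : 'I_n | kcm_sigma c (Ordinal mn) == j]%SET
  (kcm_deck c m)) -addSnnS -(add1n #|_|) -!addnA leq_add2r.
apply: leq_trans (subset_leq_card (subsetIr _ _)) _.
have [->|[j jP]] := set_0Vmem [set j : 'I_n | kcm_sigma c (Ordinal mn) == j]%SET.
  by rewrite cards0.
rewrite -(cards1 j); apply/subset_leq_card/fintype.subsetP => x; move: jP.
by rewrite !inE => /eqP -> /eqP/val_inj ->.
Qed.

Definition kcm_set (m : 'I_n) c (r : {ffun 'I_k -> 'I_n}) : draws n k :=
  [ffun t => if t == m then r else c t].

Let w (c : draws n k) (t : 'I_n) : R :=
  \prod_(i < k) ((c t i \in kcm_deck c t)%:R / #|kcm_deck c t|%:R).

Lemma kcm_deck_set (m : 'I_n) c r (t : nat) : (t <= m)%N ->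
  kcm_deck (kcm_set m c r) t = kcm_deck c t.
Proof.
move=> tm; apply/setP => j; rewrite !inE.
apply: eq_forallb => s; case: ltnP => //= st; congr (_ != _).
rewrite /kcm_sigma; apply: eq_bigr => i _; rewrite ffunE.
by rewrite (_ : (s == m) = false)//; apply/eqP => sm; move: st; rewrite sm ltnNge tm.
Qed.

Lemma sum_kcm_row (m : 'I_n) c : \sum_r w (kcm_set m c r) m = 1.
Proof.
transitivity (\sum_(r : {ffun 'I_k -> 'I_n}) \prod_(i < k)
    ((r i \in kcm_deck c m)%:R / #|kcm_deck c m|%:R : R)).
  by apply: eq_bigr => r _; apply: eq_bigr => i _; rewrite kcm_deck_set// ffunE eqxx.
rewrite -(bigA_distr_bigA (fun (i : 'I_k) (j : 'I_n) =>
  (j \in kcm_deck c m)%:R / #|kcm_deck c m|%:R)) big1// => i _.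
rewrite -mulr_suml -natr_sum -big_mkcond/= sum1_card divff//.
by rewrite pnatr_eq0 -lt0n card_kcm_deck_gt0.
Qed.

Let N : R := #|{: {ffun 'I_k -> 'I_n}}|%:R.

Lemma sum_kcm_resample (m : 'I_n) (G : draws n k -> R) :
  \sum_c \sum_r G (kcm_set m c r) = N * \sum_c G c.
Proof.
pose h (p : draws n k * {ffun 'I_k -> 'I_n}) := (kcm_set m p.1 p.2, p.1 m).
have hK : involutive h.
  move=> [c r]; rewrite /h /= ffunE eqxx; congr pair.
  by apply/ffunP => t; rewrite !ffunE; case: eqP => [->|].
rewrite pair_big/= (reindex_inj (inv_inj hK))/=.
under eq_bigr => p _.
  rewrite (_ : kcm_set m _ _ = p.1); first by over.
  by have := hK p; rewrite {1}/h/= => /(congr1 fst).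
rewrite -(pair_big predT predT (fun c _ => G c))/= mulr_sumr.
by apply: eq_bigr => c _; rewrite sumr_const -mulr_natl.
Qed.

Lemma sum_kcm_pmf : \sum_(c : draws n k) kcm_pmf R c = 1.
Proof.
have [n0|n0] := posnP n.
  transitivity (\sum_(c : draws n k) (1 : R)).
    apply: eq_bigr => c _; rewrite /kcm_pmf big1// => t.
    by have := leq_trans (ltn_ord t) (eq_leq n0); rewrite ltn0.
  by rewrite sumr_const card_ffun [X in (_ ^ X)%N]card_ord n0.
have N0 : N != 0.
  rewrite pnatr_eq0 -lt0n card_ffun !card_ord expn_gt0 n0.
  by [].
suff H m : (m <= n)%N ->
    N ^+ m * \sum_(c : draws n k) \prod_(t < n | (t < m)%N) w c t = N ^+ n.
  have := H n (leqnn n).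
  under eq_bigr => c _ do under eq_bigl => t do rewrite ltn_ord.
  by move/(canRL (mulKf (expf_neq0 n N0))); rewrite mulVf ?expf_neq0.
elim: m => [_|m IH mn].
  under eq_bigr do rewrite big_pred0//.
  rewrite sumr_const expr0 mul1r [LHS](_ : _ = #|{: draws n k}|%:R)//.
  by rewrite card_ffun card_ord natrX.
rewrite -[RHS]IH ?(ltnW mn)// exprSr -mulrA -(sum_kcm_resample (Ordinal mn)).
congr (_ * _); apply: eq_bigr => c _.
transitivity (\sum_r (\prod_(t < n | (t < m)%N) w c t) *
    w (kcm_set (Ordinal mn) c r) (Ordinal mn)); last first.
  by rewrite -mulr_sumr sum_kcm_row mulr1.
apply: eq_bigr => r _.
rewrite (bigD1 (Ordinal mn))//= mulrC; congr (_ * _).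
apply: eq_big => t; first by rewrite ltnS ltn_neqAle -val_eqE andbC.
rewrite ltnS => /andP[tm tm']; apply: eq_bigr => i _.
by rewrite kcm_deck_set// ffunE (negbTE tm').
Qed.

Lemma kcm_pmf_ge0 c : 0 <= kcm_pmf R c.
Proof. by do 2 (apply: prodr_ge0 => ? _); rewrite divr_ge0. Qed.

(* Almost surely, [kcm_sigma] is a permutation of {0, ..., n - 1}. *)
Lemma kcm_sigma_perm c : (0 < k)%N -> kcm_pmf R c != 0 ->
  injective (kcm_sigma c) /\ (forall t, (kcm_sigma c t < n)%N).
Proof.
move=> k0 c0.
have cD t i : c t i \in kcm_deck c t.
  apply: contra_neqT c0 => tiD; rewrite /kcm_pmf (bigD1 t)//= (bigD1 i)//=.
  by rewrite (negbTE tiD) !mul0r.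
have row t : exists i, kcm_sigma c t = c t i.
  have [i _ e] := eq_bigmin (Ordinal k0) predT (fun i => c t i : nat) isT
    (fun i _ => ltnW (ltn_ord (c t i))).
  by exists i; exact: e.
split=> [s t|t]; last by have [i ->] := row t.
suff H (u v : 'I_n) : (u < v)%N -> kcm_sigma c u <> kcm_sigma c v.
  by move=> e; case: (ltngtP s t) => [/H|/H|/val_inj//]; rewrite e.
move=> uv; have [i ->] := row v.
by have := cD v i; rewrite inE => /forallP/(_ u)/implyP/(_ uv)/eqP.
Qed.

End total_mass.

Definition kcm_prob (R : realType) (n k : nat) : set (draws n k) -> \bar R :=
  fun A => (\sum_(c \in A) (kcm_pmf R c)%:E)%E.

Arguments kcm_prob R n k A : clear implicits.

Section kcm_prob.
Context {R : realType} {n k : nat}.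

Local Notation P := (kcm_prob R n k).

Let kcm_prob0 : P set0 = 0%E.
Proof. by rewrite /kcm_prob fsbig_set0. Qed.

Let kcm_prob_ge0 A : (0 <= P A)%E.
Proof. by apply: fsume_ge0 => c _; rewrite lee_fin kcm_pmf_ge0. Qed.

Let kcm_prob_sigma_additive : semi_sigma_additive P.
Proof.
move=> F mF tF mUF; apply: cvg_toP.
  apply: ereal_nondecreasing_is_cvgn => a b ab.
  by apply: lee_sum_nneg_natr => // i _ _; exact: kcm_prob_ge0.
transitivity (\sum_(0 <= i <oo) (\esum_(j in F i) (kcm_pmf R j)%:E))%E.
  apply: eq_eseriesr => i _; rewrite esum_fset//; first exact: finite_finset.
  by move=> c _; rewrite lee_fin kcm_pmf_ge0.
rewrite -nneseries_sum_bigcup//=; last by move=> c; rewrite lee_fin kcm_pmf_ge0.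
rewrite esum_fset//=.
by move=> c _; rewrite lee_fin kcm_pmf_ge0.
Qed.

HB.instance Definition _ := isMeasure.Build _ _ _ P
  kcm_prob0 kcm_prob_ge0 kcm_prob_sigma_additive.

Let kcm_prob_setT : P [set: _] = 1%E.
Proof.
rewrite /kcm_prob -(sum_kcm_pmf (n := n) (k := k)) -sumEFin.
rewrite [RHS]fsbig_seq ?index_enum_uniq//; apply: eq_fsbigl.
by apply/seteqP; split => c //= _; rewrite mem_index_enum.
Qed.

HB.instance Definition _ :=
  @Measure_isProbability.Build _ _ R P kcm_prob_setT.

End kcm_prob.

Lemma measurable_draws d (T : measurableType d) (n k : nat)
  (f : draws n k -> T) : measurable_fun [set: draws n k] f.
Proof. by []. Qed.

Definition kcm_RV {R : realType} {n k : nat} (f : draws n k -> R) :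
  {RV (kcm_prob R n k) >-> R} := mfun_Sub (mem_set (measurable_draws f)).

Definition kcm_inv_mean (R : realType) (n k : nat) : R :=
  fine 'E_(kcm_prob R n k)[kcm_inv R].

Definition kcm_inv_var (R : realType) (n k : nat) : R :=
  fine 'V_(kcm_prob R n k)[kcm_inv R].

Definition kcm_a (R : realType) (k : nat) : R := (2 * (k%:R + 1))^-1.

Definition kcm_b (R : realType) (k : nat) : R :=
  k%:R / (3 * (k%:R + 1) ^+ 2 * (k%:R + 2)).

(* The [X n] and [Z] may live on different probability spaces. *)
Definition cvg_in_distribution (R : realType)
  (d : nat -> measure_display) (T : forall n, measurableType (d n))
  (P : forall n, probability (T n) R) (X : forall n, {RV (P n) >-> R})
  (d' : measure_display) (T' : measurableType d') (Q : probability T' R)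
  (Z : {RV Q >-> R}) : Prop :=
  forall x : R, {for x, continuous (cdf Z)} ->
    cdf (X n) x @[n --> \oo] --> cdf Z x.

Definition standard_normal (R : realType) (d : measure_display)
  (T : measurableType d) (Q : probability T R) (Z : {RV Q >-> R}) : Prop :=
  forall A : set R, measurable A -> distribution Q Z A = normal_prob 0 1 A.

(* Main.v *)
Require Import Defs.
From mathcomp Require Import all_boot all_order all_algebra.
From mathcomp Require Import all_classical all_reals all_analysis.
From mathcomp Require Import measurable_realfun ring lra zify.

Set Implicit Arguments.
Unset Strict Implicit.
Unset Printing Implicit Defensive.

Import Order.TTheory GRing.Theory Num.Theory.
Import numFieldNormedType.Exports.

Local Open Scope classical_set_scope.
Local Open Scope ring_scope.

(** Let [rho_t] be the rank of the card drawn at time [t] inside the deck it is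
  drawn from, that is, the number of smaller cards still in the deck. These
  smaller cards are the ones that form an inversion with the drawn card later
  on, so the number of inversions is the sum of the [rho_t]
  ([inversions_sum_rank]). Given the past, [rho_t] is the minimum of [k]
  independent uniform variables on [{0, ..., m - 1}], where [m = n - t] is the
  size of the deck; this law does not depend on the past, so the ranks are
  independent ([wmean_prod_rank], [wmean_rank_indep]).

  A sum of independent variables, each at most [n] while the standard deviation
  of the sum is of order [n ^ (3 / 2)], is asymptotically normal. This is shown
  by Stein's method. For a Lipschitz function [u] of compact support with mean
  zero under the standard normal law, the equation [f' x - x * f x = u x] has a
  solution [f] of compact support, hence with Lipschitz derivative
  ([stein_solution]). If [W] is the standardized sum, independence and a
  first-order expansion bound the mean of [f' W - W * f W] by a multiple of the
  largest summand ([stein_bound]), so the mean of [u W] tends to 0. Every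
  bounded Lipschitz function is, up to a small error controlled by Chebyshev's
  inequality, a multiple of a fixed cutoff function plus such a [u]
  ([cvg_wmean_lipschitz]); approximating the indicator of a half-line by
  Lipschitz ramps then gives the distribution functions ([cvg_wmean_le]).

  For the normalizations, [rho_t] exceeds [j] with probability
  [((m - j - 1) / m) ^ k], so its first two moments are given by the sums of the
  [k]-th and [k + 1]-st powers of the integers below [m]. Hence the mean of the
  number of inversions is [kcm_a R k * n ^ 2 + O(n)] ([sum_rank_mean_bounds])
  and the variance is [kcm_b R k * n ^ 3 + O(n ^ 2)] ([sum_rank_var_bounds]).
  The errors are negligible against [n ^ (3 / 2)] and [n ^ 3], so both
  normalizations are covered by [kcm_clt]. *)

(** * Lipschitz functions *)

Section lipschitz.
Context {R : realType}.
Implicit Types (u v : R -> R) (L B : R).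

Definition lipschitz_const L u := forall x y, `|u x - u y| <= L * `|x - y|.

Lemma lipschitz_const_ge0 L u : lipschitz_const L u -> 0 <= L.
Proof.
move=> /(_ 1 0); rewrite subr0 normr1 mulr1; exact: le_trans.
Qed.

Lemma lipschitz_const_continuous L u : lipschitz_const L u -> continuous u.
Proof.
move=> Lu x; apply/cvgrPdist_le => e e0.
have L0 := lipschitz_const_ge0 Lu.
have L1 : 0 < L + 1 by lra.
near=> y; apply: (le_trans (Lu x y)).
rewrite -[leRHS](divfK (lt0r_neq0 L1)) mulrC.
apply: ler_pM => //; last by lra.
by near: y; apply: cvgr_dist_le => //; exact: divr_gt0.
Unshelve. all: by end_near. Qed.

Lemma lipschitz_const_derive L u u' : 0 <= L ->
  (forall x : R, is_derive x 1 u (u' x)) -> (forall x, `|u' x| <= L) ->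
  lipschitz_const L u.
Proof.
move=> L0 du u'L.
suff H x y : x <= y -> `|u y - u x| <= L * `|y - x|.
  move=> x y; have [xy|yx] := leP x y; last exact/H/ltW.
  by rewrite distrC (distrC x); exact: H.
move=> xy; have [|c _ ->] := MVT_segment xy (fun z _ => du z).
  apply: continuous_subspaceT => z.
  by apply: differentiable_continuous; apply/derivable1_diffP; exact: ex_derive.
by rewrite normrM ler_wpM2r.
Qed.

Lemma lipschitz_constM L1 B1 u L2 B2 v :
  lipschitz_const L1 u -> (forall x, `|u x| <= B1) ->
  lipschitz_const L2 v -> (forall x, `|v x| <= B2) ->
  lipschitz_const (L1 * B2 + B1 * L2) (fun x => u x * v x).
Proof.
move=> Lu Bu Lv Bv x y.
have -> : u x * v x - u y * v y = (u x - u y) * v x + u y * (v x - v y) by ring.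
rewrite [leRHS]mulrDl (le_trans (ler_normD _ _))// !normrM lerD//.
  by rewrite mulrAC ler_pM.
by rewrite -mulrA ler_pM.
Qed.

Lemma lipschitz_constD L1 u L2 v :
  lipschitz_const L1 u -> lipschitz_const L2 v ->
  lipschitz_const (L1 + L2) (fun x => u x + v x).
Proof.
move=> Lu Lv x y; rewrite opprD addrACA mulrDl.
by rewrite (le_trans (ler_normD _ _))// lerD.
Qed.

Lemma lipschitz_constZ L u a : lipschitz_const L u ->
  lipschitz_const (`|a| * L) (fun x => a * u x).
Proof. by move=> Lu x y; rewrite -mulrBr normrM -mulrA ler_wpM2l. Qed.

Definition clamp01 (x : R) : R := Num.min 1 (Num.max 0 x).

Lemma clamp01_ge0 x : 0 <= clamp01 x.
Proof. by rewrite /clamp01 le_min ler01 le_max lexx. Qed.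

Lemma clamp01_le1 x : clamp01 x <= 1.
Proof. by rewrite /clamp01 ge_min lexx. Qed.

Lemma clamp01_eq0 x : x <= 0 -> clamp01 x = 0.
Proof. by move=> x0; rewrite /clamp01 (max_idPl x0) (min_idPr ler01). Qed.

Lemma clamp01_eq1 x : 1 <= x -> clamp01 x = 1.
Proof.
by move=> x1; rewrite /clamp01 (max_idPr (le_trans ler01 x1)); apply/min_idPl.
Qed.

Lemma clamp01_lipschitz L u : lipschitz_const L u ->
  lipschitz_const L (fun x => clamp01 (u x)).
Proof.
move=> Lu x y; apply: le_trans (Lu x y); move: (u x) (u y) => a b.
suff H c d : clamp01 c - clamp01 d <= `|c - d|.
  by rewrite ler_norml H andbT lerNl opprB distrC H.
have := normr_ge0 (c - d); have := ler_norm (c - d).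
move: `|c - d| => e; rewrite /clamp01 !minEle !maxEle => ce e0.
case: (leP 0 c) => c0; case: (leP 0 d) => d0; rewrite ?ler10.
- by case: (leP 1 c) => ?; case: (leP 1 d) => ?; lra.
- by case: (leP 1 c) => ?; lra.
- by case: (leP 1 d) => ?; lra.
- by lra.
Qed.

End lipschitz.

(** * Gaussian means and Stein's equation *)

Section gauss_mean.
Context {R : realType}.
Implicit Types (u v : R -> R) (L A B : R).
Local Notation mu := (@lebesgue_measure R).
Local Notation phi := (@normal_pdf R 0 1).

Definition gauss_mean u : R := \int[mu]_x (u x * phi x).

Lemma phiE (x : R) : phi x = normal_peak 1 * expR (- x ^+ 2 / 2).
Proof. by rewrite normal_pdfE ?oner_eq0// /normal_fun subr0 expr1n. Qed.

Lemma integrable_gauss u B :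
  measurable_fun [set: R] u -> (forall x, `|u x| <= B) ->
  mu.-integrable [set: R] (EFin \o (fun x => u x * phi x)).
Proof.
move=> mu_ uB.
have iB : mu.-integrable [set: R] (fun x => B%:E * (phi x)%:E)%E.
  by apply: integrableZl => //; exact: integrable_normal_pdf.
apply: le_integrable iB => //.
  apply/measurable_EFinP/measurable_funM => //; exact: measurable_normal_pdf.
move=> x _ /=; rewrite lee_fin !normrM ler_wpM2r//.
exact/(le_trans (uB x))/ler_norm.
Qed.

Lemma integrable_gauss_lipschitz u L B :
  lipschitz_const L u -> (forall x, `|u x| <= B) ->
  mu.-integrable [set: R] (EFin \o (fun x => u x * phi x)).
Proof.
move=> Lu; apply: integrable_gauss.
by apply: continuous_measurable_fun; exact: lipschitz_const_continuous Lu.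
Qed.

Lemma gauss_mean1 : gauss_mean (fun=> 1) = 1.
Proof.
rewrite /gauss_mean; under eq_Rintegral do rewrite mul1r.
by rewrite /Rintegral integral_normal_pdf.
Qed.

Lemma gauss_mean_le u v :
  mu.-integrable [set: R] (EFin \o (fun x => u x * phi x)) ->
  mu.-integrable [set: R] (EFin \o (fun x => v x * phi x)) ->
  (forall x, u x <= v x) -> gauss_mean u <= gauss_mean v.
Proof.
move=> iu iv uv; apply: le_Rintegral => // x _.
by rewrite ler_wpM2r ?normal_pdf_ge0.
Qed.

Lemma gauss_meanB u v :
  mu.-integrable [set: R] (EFin \o (fun x => u x * phi x)) ->
  mu.-integrable [set: R] (EFin \o (fun x => v x * phi x)) ->
  gauss_mean (fun x => u x - v x) = gauss_mean u - gauss_mean v.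
Proof.
move=> iu iv; rewrite /gauss_mean -RintegralB//.
by apply: eq_Rintegral => x _; rewrite mulrBl.
Qed.

Lemma gauss_meanZ u a :
  mu.-integrable [set: R] (EFin \o (fun x => u x * phi x)) ->
  gauss_mean (fun x => a * u x) = a * gauss_mean u.
Proof.
move=> iu; rewrite /gauss_mean -RintegralZl//.
by apply: eq_Rintegral => x _; rewrite mulrA.
Qed.

Lemma gauss_mean_indic (D : set R) : measurable D ->
  (gauss_mean \1_D)%:E = normal_prob 0 1 D.
Proof.
move=> mA; rewrite /gauss_mean /Rintegral /normal_prob.
rewrite [in RHS]integral_mkcond fineK; last first.
  apply: integrable_fin_num => //; apply: (@integrable_gauss _ 1).
    exact: measurable_indic.
  by move=> x; rewrite indicE; case: (_ \in _); rewrite ?normr1 ?normr0.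
apply: eq_integral => x _; rewrite patchE indicE.
by case: (x \in D); rewrite ?mul1r ?mul0r.
Qed.

(** The quotient by the density of the integral of [u * phi] up to [x] solves
  the equation and vanishes before the support of [u]; as [u] has mean zero, it
  also vanishes after the support. A solution of compact support is bounded, so
  by the equation [f'] is bounded, so [f] and [x * f x] are Lipschitz, and by
  the equation again [f'] is Lipschitz. *)
Lemma stein_solution u L B A :
  lipschitz_const L u -> (forall x, `|u x| <= B) ->
  (forall x, A < `|x| -> u x = 0) -> gauss_mean u = 0 ->
  exists f f' C, [/\ forall x : R, is_derive x 1 f (f' x),
    lipschitz_const C f' & forall x, f' x - x * f x = u x].
Proof.
move=> Lu uB uA u0.
wlog A0 : A uA / 0 <= A.
  move=> h; apply: (h (Num.max 0 A)); last by rewrite le_max lexx.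
  by move=> x; rewrite gt_max => /andP[_]; exact: uA.
have iu := integrable_gauss_lipschitz Lu uB.
pose F x := \int[mu]_(t in `]-oo, x]) (u t * phi t).
pose e (x : R) : R := (normal_peak 1)^-1 * expR (x ^+ 2 / 2).
have pk : normal_peak (1 : R) != 0 by rewrite gt_eqF// normal_peak_gt0// oner_eq0.
have ephi x : e x * phi x = 1.
  rewrite phiE /e mulrACA mulVf// mul1r -expRD mulNr addrN; exact: expR0.
pose f x := F x * e x.
pose f' x := u x + x * f x.
have dF (x : R) : is_derive x 1 F (u x * phi x).
  have iu1 : mu.-integrable [set` `]-oo, (x + 1)]] (EFin \o (fun x => u x * phi x)).
    exact: integrableS iu.
  have cu : {for x, continuous (fun x => u x * phi x)}.
    apply: cvgM; first exact: (lipschitz_const_continuous Lu).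
    by apply: continuous_normal_pdf; rewrite oner_eq0.
  have xx1 : x < x + 1 by rewrite ltrDl.
  have [d1 d2] := continuous_FTC1 xx1 iu1 (ltNyr _) cu.
  by apply: DeriveDef => //; rewrite -derive1E.
have de (x : R) : is_derive x 1 e (x * e x).
  rewrite /e; apply: is_derive_eq.
  rewrite /GRing.scale/=; field.
  done.
have df (x : R) : is_derive x 1 f (f' x).
  rewrite /f; apply: is_derive_eq; rewrite /GRing.scale/= /f' /f.
  have := ephi x; have := u x; move: (phi x) (e x) (F x) => p q r v h.
  rewrite -[in RHS](mulr1 (u x)) -h; ring.
have R0 D : \int[mu]_(t in D) (cst 0 t : R) = 0 by rewrite /Rintegral integral0.
have F0 x : A < `|x| -> F x = 0.
  move=> Ax; have [x0|x0] := leP 0 x.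
    rewrite ger0_norm// in Ax.
    have := @Rintegral_itvB R _ -oo%O +oo%O x (integrableS _ _ _ iu) isT isT.
    rewrite set_itvNyy => /(_ measurableT measurableT (@subset_refl _ _)).
    rewrite -/(gauss_mean u) u0 -/(F x) (@eq_Rintegral _ _ _ _ _ (cst 0)).
      by rewrite /= R0 sub0r => /eqP; rewrite oppr_eq0 => /eqP.
    move=> t /[!inE]/=; rewrite in_itv/= andbT => xt; rewrite uA ?mul0r//.
    by rewrite (lt_le_trans _ (ler_norm _))// (lt_trans Ax).
  rewrite ltr0_norm// in Ax.
  rewrite /F (@eq_Rintegral _ _ _ _ _ (cst 0)) ?R0//.
  move=> t /[!inE]/=; rewrite in_itv/= => xt; rewrite uA ?mul0r//.
  rewrite (lt_le_trans Ax)// -normrN (le_trans _ (ler_norm _))//.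
  by rewrite lerN2.
have f0 x : A < `|x| -> f x = 0 by move=> /F0; rewrite /f => ->; rewrite mul0r.
have [M fM] : exists M, forall x, `|f x| <= M.
  exists (`|B| * e A) => x; have [/f0->|xA] := ltP A `|x|.
    by rewrite normr0 mulr_ge0// mulr_ge0 ?expR_ge0// invr_ge0 normal_peak_ge0.
  rewrite /f normrM ler_pM//.
    have iphi : mu.-integrable [set: R] (EFin \o (fun t => `|B| * phi t)).
      apply: (@integrable_gauss _ `|B|) => [|x' ]; last by rewrite normr_id.
      exact: measurable_cst.
    have iux : mu.-integrable [set` `]-oo, x]] (EFin \o (fun t => u t * phi t)).
      exact: integrableS iu.
    rewrite (le_trans (le_normr_Rintegral _ iux))//.
    apply: (@le_trans _ _ (\int[mu]_(t in `]-oo, x]) (`|B| * phi t))).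
      apply: le_Rintegral => //; [exact: integrable_norm|exact: integrableS iphi|].
      move=> t _; rewrite normrM (ger0_norm (normal_pdf_ge0 _ _ _)).
      by rewrite ler_wpM2r ?normal_pdf_ge0// (le_trans (uB t))// ler_norm.
    apply: (@le_trans _ _ (\int[mu]_t (`|B| * phi t))); last first.
      rewrite RintegralZl//; last exact: integrable_normal_pdf.
      by rewrite /Rintegral integral_normal_pdf mulr1.
    rewrite fine_le//; [|exact: integrable_fin_num|].
      by apply: integrable_fin_num => //; exact: integrableS iphi.
    apply: ge0_subset_integral => //; first
      by apply/measurable_EFinP; apply: measurable_funM => //;
      exact: measurable_normal_pdf.
    by move=> t _; rewrite lee_fin mulr_ge0// normal_pdf_ge0.
  rewrite ger0_norm ?mulr_ge0 ?expR_ge0 ?invr_ge0 ?normal_peak_ge0//.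
  rewrite ler_wpM2l ?invr_ge0 ?normal_peak_ge0// ler_expR ler_pM2r//.
  by rewrite -real_normK ?num_real// lerXn2r ?nnegrE.
have M0 : 0 <= M by apply: le_trans (fM 0).
have B0 : 0 <= B by apply: le_trans (uB 0).
have Axf v D : (forall x, A < `|x| -> v x = 0) -> (forall x, `|v x| <= D) ->
    forall x, `|x * v x| <= A * D.
  move=> v0 vD x; have [/v0->|xA] := ltP A `|x|.
    by rewrite mulr0 normr0 mulr_ge0// (le_trans _ (vD 0)).
  by rewrite normrM ler_pM.
have f'B x : `|f' x| <= B + A * M.
  by rewrite (le_trans (ler_normD _ _))// lerD// Axf.
have f'0 x : A < `|x| -> f' x = 0.
  by move=> xA; rewrite /f' f0// uA// mulr0 addr0.
exists f, f', (L + (M + A * (B + A * M))); split => //.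
- apply: lipschitz_constD => //.
  apply: (@lipschitz_const_derive _ _ _ (fun x => f x + x * f' x)).
  + by rewrite addr_ge0// mulr_ge0// addr_ge0// mulr_ge0.
  + move=> x; apply: is_derive_eq; rewrite /GRing.scale/=; ring.
  + by move=> x; rewrite (le_trans (ler_normD _ _))// lerD// Axf.
- by move=> x; rewrite /f' addrK.
Qed.

End gauss_mean.

(** * Convergence in distribution from Stein's test functions *)

Section cutoff.
Context {R : realType}.
Local Notation mu := (@lebesgue_measure R).
Local Notation phi := (@normal_pdf R 0 1).

Definition cutoff (K x : R) : R := clamp01 (K + 1 - `|x|).

Lemma cutoff_lipschitz K : lipschitz_const 1 (cutoff K).
Proof.
apply: clamp01_lipschitz => x y; rewrite mul1r.
have -> : K + 1 - `|x| - (K + 1 - `|y|) = `|y| - `|x| by ring.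
by rewrite (distrC x) ler_dist_dist.
Qed.

Lemma cutoff_ge0 K x : 0 <= cutoff K x. Proof. exact: clamp01_ge0. Qed.

Lemma cutoff_le1 K x : cutoff K x <= 1. Proof. exact: clamp01_le1. Qed.

Lemma norm_cutoff K x : `|cutoff K x| <= 1.
Proof. by rewrite ger0_norm ?cutoff_ge0// cutoff_le1. Qed.

Lemma cutoff_eq0 K x : K + 1 < `|x| -> cutoff K x = 0.
Proof. by move=> Kx; apply: clamp01_eq0; lra. Qed.

Lemma cutoff_eq1 K x : `|x| <= K -> cutoff K x = 1.
Proof. by move=> Kx; apply: clamp01_eq1; lra. Qed.

Lemma integrable_cutoff K :
  mu.-integrable [set: R] (EFin \o (fun x => cutoff K x * phi x)).
Proof.
by apply: integrable_gauss_lipschitz (@norm_cutoff _); exact: cutoff_lipschitz.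
Qed.

Lemma cvg_gauss_mean_cutoff : gauss_mean (cutoff n%:R) @[n --> \oo] --> (1 : R).
Proof.
apply: fine_cvg; rewrite -(integral_normal_pdf 0 1).
have mphi := @measurable_normal_pdf R 0 1.
apply: (@dominated_cvg _ _ _ mu setT measurableT
  (fun n x => (cutoff n%:R x * phi x)%:E) (EFin \o phi) (EFin \o phi)).
- move=> n; exact: (measurable_int _ (integrable_cutoff n%:R)).
- move=> x _; apply: cvg_EFin; first exact: nearW.
  apply: cvg_near_cst; near=> n; rewrite /= cutoff_eq1 ?mul1r//.
  near: n; exact: nbhs_infty_ger.
- by [].
- exact: integrable_normal_pdf.
- move=> n x _; rewrite lee_fin normrM.
  rewrite [`|phi x|]ger0_norm ?normal_pdf_ge0//.
  by rewrite ler_piMl ?normal_pdf_ge0 ?norm_cutoff.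
Unshelve. all: by end_near. Qed.

End cutoff.

Section weighted_mean.
Context {R : realType} {T : finType} (p : T -> R).
Implicit Types X Y : T -> R.

Definition wmean X : R := \sum_c p c * X c.

Lemma wmeanD X Y : wmean (fun c => X c + Y c) = wmean X + wmean Y.
Proof. by rewrite /wmean -big_split; apply: eq_bigr => c _; rewrite mulrDr. Qed.

Lemma wmeanZ a X : wmean (fun c => a * X c) = a * wmean X.
Proof. by rewrite /wmean mulr_sumr; apply: eq_bigr => c _; rewrite mulrCA. Qed.

Lemma wmeanB X Y : wmean (fun c => X c - Y c) = wmean X - wmean Y.
Proof. by rewrite /wmean -sumrB; apply: eq_bigr => c _; rewrite mulrBr. Qed.

Lemma wmean_sum (I : Type) (r : seq I) (P : pred I) (X : I -> T -> R) :
  wmean (fun c => \sum_(i <- r | P i) X i c) = \sum_(i <- r | P i) wmean (X i).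
Proof.
by rewrite /wmean exchange_big; apply: eq_bigr => c _; rewrite mulr_sumr.
Qed.

Lemma eq_wmean X Y : X =1 Y -> wmean X = wmean Y.
Proof. by move=> XY; apply: eq_bigr => c _; rewrite XY. Qed.

Hypothesis p_ge0 : forall c, 0 <= p c.

Lemma wmean_le X Y : (forall c, X c <= Y c) -> wmean X <= wmean Y.
Proof. by move=> XY; apply: ler_sum => c _; rewrite ler_wpM2l. Qed.

Lemma wmean_norm X : `|wmean X| <= wmean (fun c => `|X c|).
Proof.
apply: (le_trans (ler_norm_sum _ _ _)); apply: ler_sum => c _.
by rewrite normrM ger0_norm.
Qed.

Hypothesis p_sum1 : \sum_c p c = 1.

Lemma wmean_cst a : wmean (fun=> a) = a.
Proof. by rewrite /wmean -mulr_suml p_sum1 mul1r. Qed.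

End weighted_mean.

Section stein_criterion.
Context {R : realType}.
Local Notation phi := (@normal_pdf R 0 1).
Variables (T : nat -> finType) (p Y : forall n, T n -> R) (M : R).
Arguments p : clear implicits.
Arguments Y : clear implicits.
Hypothesis p_ge0 : forall n c, 0 <= p n c.
Hypothesis p_sum1 : forall n, \sum_c p n c = 1.
Hypothesis Y2 : \forall n \near \oo, wmean (p n) (fun c => Y n c ^+ 2) <= M.
Hypothesis stein : forall u L B A, lipschitz_const L u ->
  (forall x, `|u x| <= B) -> (forall x, A < `|x| -> u x = 0) ->
  gauss_mean u = 0 -> wmean (p n) (fun c => u (Y n c)) @[n --> \oo] --> 0.

(** Chebyshev's inequality: [1 - cutoff K y] is at most [y ^+ 2 / K ^+ 2]. *)
Lemma wmean_cutoff (K : R) n : 0 < K ->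
  wmean (p n) (fun c => 1 - cutoff K (Y n c)) <=
  wmean (p n) (fun c => Y n c ^+ 2) / K ^+ 2.
Proof.
move=> K0; rewrite mulrC -wmeanZ; apply: wmean_le => // c.
have [YK|YK] := leP `|Y n c| K.
  by rewrite cutoff_eq1// subrr mulr_ge0 ?invr_ge0 ?sqr_ge0.
apply: (@le_trans _ _ 1); first by have := cutoff_ge0 K (Y n c); lra.
rewrite mulrC ler_pdivlMr ?exprn_gt0// mul1r -[leRHS]real_normK ?num_real//.
by rewrite lerXn2r ?nnegrE ?ltW// (lt_trans K0).
Qed.

(** With [h] the product of [g] by a wide cutoff, the hypothesis on Stein's test
  functions applies to the combination of [h] and the cutoff that has Gaussian
  mean zero. The means of the cutoff itself are close to 1 on both sides. *)
Lemma cvg_wmean_lipschitz g L B : lipschitz_const L g ->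
  (forall x, `|g x| <= B) ->
  wmean (p n) (fun c => g (Y n c)) @[n --> \oo] --> gauss_mean g.
Proof.
move=> Lg gB; apply/cvgrPdist_le => eps eps0.
have B0 : 0 <= B by apply: le_trans (gB 0).
pose h (K x : R) := g x * cutoff K x.
have Lh K : lipschitz_const (L * 1 + B * 1) (h K).
  by apply: lipschitz_constM => //; [exact: cutoff_lipschitz|exact: norm_cutoff].
have hB K x : `|h K x| <= B.
  by rewrite normrM -[B]mulr1 ler_pM ?norm_cutoff.
have ih K := integrable_gauss_lipschitz (Lh K) (hB K).
have ig := integrable_gauss_lipschitz Lg gB.
have i1 : (@lebesgue_measure R).-integrable [set: R] (EFin \o (fun x => 1 * phi x)).
  by apply: (@integrable_gauss _ _ 1) => [|x]; rewrite ?normr1.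
(* five errors add up at the end: four are at most [B * eta], one is at most
   [eta] *)
pose eta := eps / (8 * (B + 1)).
have eta0 : 0 < eta by rewrite divr_gt0// mulr_gt0//; lra.
have [K [K0 KM gK]] : exists K : R, [/\ 0 < K, M / K ^+ 2 <= eta &
    1 - gauss_mean (cutoff K) <= eta].
  have /cvgrPdist_le/(_ _ eta0) c1 := @cvg_gauss_mean_cutoff R.
  near \oo => n; exists n%:R; split.
  - near: n; exact: nbhs_infty_gtr.
  - have n1 : 1 <= n%:R :> R by near: n; exact: nbhs_infty_ger.
    rewrite ler_pdivrMr ?exprn_gt0 ?(lt_le_trans ltr01)//.
    rewrite mulrC -ler_pdivrMr// (@le_trans _ _ n%:R)//.
      by near: n; exact: nbhs_infty_ger.
    by rewrite expr2 ler_peMr// (le_trans ler01).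
  - rewrite (le_trans (ler_norm _))//; near: n; exact: c1.
pose gam := gauss_mean (cutoff K).
have gam0 : 0 <= gam.
  have -> : 0 = gauss_mean (fun x => 0 * cutoff K x).
    by rewrite (gauss_meanZ _ (integrable_cutoff K)) mul0r.
  apply: gauss_mean_le (integrable_cutoff _) _ => [|x].
    apply: (integrable_gauss_lipschitz (B := 0)
      (lipschitz_constZ 0 (cutoff_lipschitz K))).
    by move=> x; rewrite mul0r normr0.
  by rewrite mul0r cutoff_ge0.
have gam1 : gam <= 1.
  rewrite -gauss_mean1; apply: gauss_mean_le i1 _ => [|x]; last exact: cutoff_le1.
  exact: integrable_cutoff.
(* subtracting the right multiple of the cutoff kills the Gaussian mean while
   keeping the support compact *)
pose u x := gam * h K x + (- gauss_mean (h K)) * cutoff K x.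
have Eu : wmean (p n) (fun c => u (Y n c)) @[n --> \oo] --> 0.
  apply: (stein (L := `|gam| * (L * 1 + B * 1) + `|- gauss_mean (h K)| * 1)
    (B := `|gam| * B + `|- gauss_mean (h K)| * 1) (A := K + 1)).
  - apply: lipschitz_constD; apply: lipschitz_constZ => //; exact: cutoff_lipschitz.
  - move=> x; rewrite (le_trans (ler_normD _ _))// lerD//.
      by rewrite normrM; apply: ler_wpM2l.
    by rewrite normrM; apply: ler_wpM2l => //; exact: norm_cutoff.
  - by move=> x Kx; rewrite /u /h cutoff_eq0// !mulr0 addr0.
  - rewrite [u](_ : _ = fun x => gam * h K x - gauss_mean (h K) * cutoff K x).
      rewrite (@gauss_meanB _ (fun x => gam * h K x)
        (fun x => gauss_mean (h K) * cutoff K x)).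
      - rewrite (gauss_meanZ _ (ih K)) (gauss_meanZ _ (integrable_cutoff K)).
        by rewrite mulrC subrr.
      - apply: integrable_gauss_lipschitz (lipschitz_constZ _ (Lh K)) _ => x.
        by rewrite normrM; exact: ler_wpM2l.
      - apply: integrable_gauss_lipschitz (lipschitz_constZ _ (cutoff_lipschitz K)) _ => x.
        by rewrite normrM; apply: ler_wpM2l => //; exact: norm_cutoff.
    by apply/funext => x; rewrite /u mulNr.
have dh : `|gauss_mean g - gauss_mean (h K)| <= B * eta.
  have ic := integrable_cutoff K.
  have i1c : (@lebesgue_measure R).-integrable [set: R]
      (EFin \o (fun x => (1 - cutoff K x) * phi x)).
    have := integrableB measurableT i1 ic; apply: eq_integrable => // x _ /=.
    by rewrite -EFinB mulrBl.
  have ghB x : `|g x - h K x| <= B * (1 - cutoff K x).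
    rewrite /h -{1}[g x]mulr1 -mulrBr normrM.
    by rewrite ler_pM// ger0_norm// subr_ge0 cutoff_le1.
  have iBc a : (@lebesgue_measure R).-integrable [set: R]
      (EFin \o (fun x => (a * (1 - cutoff K x)) * phi x)).
    have := integrableZl measurableT a i1c; apply: eq_integrable => // x _ /=.
    by rewrite -EFinM mulrA.
  have igh : (@lebesgue_measure R).-integrable [set: R]
      (EFin \o (fun x => (g x - h K x) * phi x)).
    have := integrableB measurableT ig (ih K); apply: eq_integrable => // x _ /=.
    by rewrite -EFinB mulrBl.
  have g1c : gauss_mean (fun x => 1 - cutoff K x) <= eta.
    by rewrite (gauss_meanB i1 ic) gauss_mean1.
  rewrite -(gauss_meanB ig (ih K)) ler_norml; apply/andP; split.
    rewrite lerNl.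
    apply: (@le_trans _ _ (- gauss_mean (fun x => (- B) * (1 - cutoff K x)))).
      rewrite lerN2; apply: gauss_mean_le => // x.
      by have := ghB x; rewrite ler_norml mulNr => /andP[].
    by rewrite (gauss_meanZ _ i1c) mulNr opprK ler_wpM2l.
  apply: (@le_trans _ _ (gauss_mean (fun x => B * (1 - cutoff K x)))).
    by apply: gauss_mean_le => // x; rewrite (le_trans (ler_norm _)).
  by rewrite (gauss_meanZ _ i1c) ler_wpM2l.
move/cvgr0_norm_le : Eu => /(_ _ eta0) Eu.
near=> n.
have tight : wmean (p n) (fun c => 1 - cutoff K (Y n c)) <= eta.
  apply: (le_trans (wmean_cutoff n K0)); apply: le_trans KM.
  rewrite ler_pM2r ?invr_gt0 ?exprn_gt0//; near: n; exact: Y2.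
have dEh : `|wmean (p n) (fun c => g (Y n c)) - wmean (p n) (fun c => h K (Y n c))|
    <= B * eta.
  rewrite -wmeanB; apply: (le_trans (wmean_norm _ _)) => //.
  apply: (@le_trans _ _ (wmean (p n) (fun c => B * (1 - cutoff K (Y n c))))).
    apply: wmean_le => // c; rewrite /h -{1}[g _]mulr1 -mulrBr normrM.
    by rewrite ler_pM// ger0_norm// subr_ge0 cutoff_le1.
  by rewrite wmeanZ ler_wpM2l.
have Ehb : `|wmean (p n) (fun c => h K (Y n c))| <= B.
  apply: (le_trans (wmean_norm _ _)) => //.
  by rewrite -[leRHS](wmean_cst (p_sum1 n)); apply: wmean_le.
have un : `|wmean (p n) (fun c => u (Y n c))| <= eta by near: n.
have gmB : `|gauss_mean (h K)| <= B.
  have iB a : (@lebesgue_measure R).-integrable [set: R]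
      (EFin \o (fun x => a * 1 * phi x)).
    by apply: (@integrable_gauss _ _ `|a|) => [|x]; rewrite ?mulr1.
  rewrite ler_norml; apply/andP; split.
    rewrite lerNl (@le_trans _ _ (- gauss_mean (fun=> (- B) * 1)))//.
      rewrite lerN2; apply: gauss_mean_le => // x.
      by have := hB K x; rewrite ler_norml mulr1 => /andP[].
    by rewrite (gauss_meanZ _ i1) gauss_mean1 mulr1 opprK.
  rewrite (@le_trans _ _ (gauss_mean (fun=> B * 1)))//.
    by apply: gauss_mean_le => // x; rewrite mulr1 (le_trans (ler_norm _)).
  by rewrite (gauss_meanZ _ i1) gauss_mean1 mulr1.
have Beta : 4 * (B * eta) + eta <= eps.
  have -> : 4 * (B * eta) + eta = (4 * B + 1) * (eps / (8 * (B + 1))).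
    by rewrite /eta; ring.
  rewrite mulrA ler_pdivrMr; [nra|lra].
apply: le_trans Beta.
pose Eh := wmean (p n) (fun c => h K (Y n c)).
pose Ec := wmean (p n) (fun c => cutoff K (Y n c)).
have tight' : wmean (p n) (fun c => 1 - cutoff K (Y n c)) = 1 - Ec.
  by rewrite wmeanB wmean_cst.
have Ec1 : Ec <= 1.
  by rewrite -[leRHS](wmean_cst (p_sum1 n)); apply: wmean_le => // c; exact: cutoff_le1.
rewrite tight' in tight.
have Eun : wmean (p n) (fun c => u (Y n c)) = gam * Eh - gauss_mean (h K) * Ec.
  by rewrite wmeanD !wmeanZ mulNr.
rewrite Eun in un.
rewrite -/Eh in dEh Ehb.
have -> : gauss_mean g - wmean (p n) (fun c => g (Y n c)) =
  (gauss_mean g - gauss_mean (h K)) + gauss_mean (h K) * (1 - Ec)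
  - (gam * Eh - gauss_mean (h K) * Ec) - (1 - gam) * Eh
  - (wmean (p n) (fun c => g (Y n c)) - Eh) by ring.
have h1 : `|gauss_mean (h K) * (1 - Ec)| <= B * eta.
  by rewrite normrM ler_pM// ger0_norm// subr_ge0.
have h2 : `|(1 - gam) * Eh| <= B * eta.
  by rewrite mulrC normrM ler_pM// ger0_norm// subr_ge0.
move: dh dEh h1 h2 un; rewrite !ler_norml.
move=> /andP[? ?] /andP[? ?] /andP[? ?] /andP[? ?] /andP[? ?].
apply/andP; split; lra.
Unshelve. all: by end_near. Qed.

(** The indicator of the half-line lies between two ramps, one falling from 1 to
  0 just before [x] and the other just after. *)
Lemma cvg_wmean_le (x : R) :
  {for x, continuous (fun y : R => gauss_mean \1_`]-oo, y])} ->
  wmean (p n) (fun c => (Y n c <= x)%R%:R) @[n --> \oo] -->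
  (gauss_mean \1_`]-oo, x] : R).
Proof.
set Phi := (fun y : R => _) => cPhi; rewrite -/(Phi x).
apply/cvgrPdist_le => eps eps0.
have e2 : 0 < eps / 2 by rewrite divr_gt0.
move/cvgrPdist_le : cPhi => /(_ _ e2)/nbhs_ballP[d /= d0 dPhi].
pose dd := d / 2; have dd0 : 0 < dd by rewrite divr_gt0.
pose ramp a y := clamp01 ((a + dd - y) / dd).
have rL a : lipschitz_const dd^-1 (ramp a).
  apply: clamp01_lipschitz => y z.
  have -> : (a + dd - y) / dd - (a + dd - z) / dd = dd^-1 * (z - y) by ring.
  by rewrite normrM (distrC y) ger0_norm// invr_ge0 ltW.
have rB a y : `|ramp a y| <= 1.
  by rewrite ger0_norm ?clamp01_le1 ?clamp01_ge0.
have r1 a y : y <= a -> ramp a y = 1.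
  by move=> ya; apply: clamp01_eq1; rewrite ler_pdivlMr//; lra.
have r0 a y : a + dd <= y -> ramp a y = 0.
  by move=> ya; apply: clamp01_eq0; rewrite pmulr_lle0 ?invr_gt0//; lra.
have indle a y : (a <= y)%R%:R = \1_`]-oo, y] a :> R.
  by rewrite indicE mem_setE in_itv.
have iI y : (@lebesgue_measure R).-integrable [set: R]
    (EFin \o (fun z => \1_`]-oo, y] z * phi z)).
  apply: (@integrable_gauss _ _ 1); first exact: measurable_indic.
  by move=> z; rewrite indicE; case: (_ \in _); rewrite ?normr1 ?normr0.
have ir a := integrable_gauss_lipschitz (rL a) (rB a).
have ramp_ub a y : (y <= a)%R%:R <= ramp a y.
  by case: (leP y a) => [ya|_]; [rewrite r1|exact: clamp01_ge0].
have ramp_lb a y : ramp a y <= (y <= a + dd)%R%:R.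
  by case: (leP y (a + dd)) => [_|ya]; [exact: clamp01_le1|rewrite r0// ltW].
have near_x a : `|x - a| < d -> `|Phi x - Phi a| <= eps / 2.
  by move=> xa; exact: dPhi.
have up : gauss_mean (ramp x) <= Phi x + eps / 2.
  apply: (@le_trans _ _ (Phi (x + dd))).
    by apply: gauss_mean_le => // y; rewrite -indle.
  have := near_x (x + dd); rewrite opprD addNKr normrN gtr0_norm// => /(_ _).
  by rewrite ler_norml => /(_ ltac:(rewrite /dd; lra))/andP[]; lra.
have lo : Phi x - eps / 2 <= gauss_mean (ramp (x - dd)).
  apply: (@le_trans _ _ (Phi (x - dd))).
    have := near_x (x - dd); rewrite opprB addrC subrK gtr0_norm// => /(_ _).
    by rewrite ler_norml => /(_ ltac:(rewrite /dd; lra))/andP[]; lra.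
  by apply: gauss_mean_le => // y; rewrite -indle.
have /cvgrPdist_le/(_ _ e2) cu := cvg_wmean_lipschitz (rL x) (rB x).
have /cvgrPdist_le/(_ _ e2) cl := cvg_wmean_lipschitz (rL (x - dd)) (rB (x - dd)).
near=> n.
have : `|gauss_mean (ramp x) - wmean (p n) (fun c => ramp x (Y n c))| <= eps / 2.
  by near: n.
have : `|gauss_mean (ramp (x - dd)) -
    wmean (p n) (fun c => ramp (x - dd) (Y n c))| <= eps / 2.
  by near: n.
have : wmean (p n) (fun c => (Y n c <= x)%R%:R) <=
    wmean (p n) (fun c => ramp x (Y n c)).
  by apply: wmean_le => // c.
have : wmean (p n) (fun c => ramp (x - dd) (Y n c)) <=
    wmean (p n) (fun c => (Y n c <= x)%R%:R).
  by apply: wmean_le => // c; rewrite -{2}[x](subrK dd).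
rewrite !ler_norml => ? ? /andP[? ?] /andP[? ?].
apply/andP; split; lra.
Unshelve. all: by end_near. Qed.

End stein_criterion.

(** * Stein's bound for a sum of independent variables *)

Lemma taylor1_lipschitz (R : realType) (f f' : R -> R) C (x y : R) :
  (forall z : R, is_derive z 1 f (f' z)) -> lipschitz_const C f' ->
  `|f (x + y) - f x - y * f' x| <= C * y ^+ 2.
Proof.
move=> df Cf'; have C0 := lipschitz_const_ge0 Cf'.
have cf (A : set R) : {within A, continuous f}.
  apply: continuous_subspaceT => z.
  by apply: differentiable_continuous; apply/derivable1_diffP; exact: ex_derive.
suff [c cy ->] : exists2 c, `|c - x| <= `|y| & f (x + y) - f x = f' c * y.
  rewrite (mulrC y) -mulrBl normrM -[y ^+ 2]real_normK ?num_real//.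
  rewrite expr2 mulrA ler_wpM2r//.
  by rewrite (le_trans (Cf' _ _))// ler_wpM2l.
have [y0|y0] := leP 0 y.
  have [|c /[!in_itv]/= /andP[xc cy] e] :=
      @MVT_segment _ f f' x (x + y) _ (fun z _ => df z) (cf _).
    by rewrite lerDl.
  by exists c; [rewrite !ger0_norm//; lra|rewrite e addrC addKr].
have [|c /[!in_itv]/= /andP[xc cy] e] :=
    @MVT_segment _ f f' (x + y) x _ (fun z _ => df z) (cf _).
  by rewrite gerDl ltW.
exists c; first by rewrite ler0_norm ?ltr0_norm//; lra.
by rewrite -opprB e; ring.
Qed.

Section stein_independent_sum.
Context {R : realType} {T : finType} (p : T -> R) {n : nat} (xi : 'I_n -> T -> R).
Variable delta : R.
Hypothesis p_ge0 : forall c, 0 <= p c.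
Hypothesis p_sum1 : \sum_c p c = 1.

Let W c := \sum_i xi i c.

Hypothesis indep : forall i (G H : R -> R),
  wmean p (fun c => G (xi i c) * H (W c - xi i c)) =
  wmean p (fun c => G (xi i c)) * wmean p (fun c => H (W c - xi i c)).
Hypothesis xi_mean0 : forall i, wmean p (xi i) = 0.

Lemma wmean_sum_sqr :
  wmean p (fun c => W c ^+ 2) = \sum_i wmean p (fun c => xi i c ^+ 2).
Proof.
rewrite (@eq_wmean _ _ _ _ (fun c => \sum_i
    (xi i c ^+ 2 + xi i c * (W c - xi i c)))); last first.
  by move=> c; rewrite expr2 {1}/W mulr_suml; apply: eq_bigr => i _; ring.
rewrite wmean_sum; apply: eq_bigr => i _.
by rewrite wmeanD (indep i id id) xi_mean0 mul0r addr0.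
Qed.

Hypothesis xi_bound : forall i c, `|xi i c| <= delta.
Hypothesis xi_var1 : \sum_i wmean p (fun c => xi i c ^+ 2) = 1.

(** Stein's bound. With [W'] for [W] without its term [xi i], independence and
  centering turn the mean of [xi i * f W] into that of
  [xi i * (f W - f W')], which a first-order expansion at [W'] replaces by
  the variance of [xi i] times the mean of [f' W'], and then of [f' W]. Each
  of the two replacements costs at most [C * delta] times the variance. *)
Lemma stein_bound (f f' : R -> R) C :
  (forall z : R, is_derive z 1 f (f' z)) -> lipschitz_const C f' ->
  `|wmean p (fun c => f' (W c) - W c * f (W c))| <= 2 * C * delta.
Proof.
move=> df Cf'; have C0 := lipschitz_const_ge0 Cf'.
pose W' i c := W c - xi i c.
pose s2 i := wmean p (fun c => xi i c ^+ 2).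
have s2_ge0 i : 0 <= s2 i.
  by rewrite -(wmean_cst p_sum1 0) wmean_le// => c; exact: sqr_ge0.
suff H i : `|s2 i * wmean p (fun c => f' (W c)) -
    wmean p (fun c => xi i c * f (W c))| <= s2 i * (2 * C * delta).
  rewrite wmeanB -[X in `|X - _|]mul1r -{1}xi_var1 mulr_suml.
  rewrite (@eq_wmean _ _ _ (fun c => W c * f (W c))
    (fun c => \sum_i xi i c * f (W c))); last first.
    by move=> c; rewrite mulr_suml.
  rewrite wmean_sum -sumrB; apply: (le_trans (ler_norm_sum _ _ _)).
  rewrite -[leRHS]mul1r -[X in _ <= X * _]xi_var1 mulr_suml.
  by apply: ler_sum => i _; exact: H.
have E1 : wmean p (fun c => xi i c * f (W' i c)) = 0.
  by rewrite (indep i id f) xi_mean0 mul0r.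
have E2 : wmean p (fun c => xi i c ^+ 2 * f' (W' i c)) =
    s2 i * wmean p (fun c => f' (W' i c)).
  exact: (indep i (fun x => x ^+ 2) f').
have -> : s2 i * wmean p (fun c => f' (W c)) -
    wmean p (fun c => xi i c * f (W c)) =
    s2 i * wmean p (fun c => f' (W c) - f' (W' i c)) -
    wmean p (fun c => xi i c * (f (W c) - f (W' i c) - xi i c * f' (W' i c))).
  rewrite (@eq_wmean _ _ _ (fun c => _ * (_ - _ - _))
    (fun c => xi i c * f (W c) - xi i c * f (W' i c) - xi i c ^+ 2 * f' (W' i c))).
    by rewrite !wmeanB E1 E2; ring.
  by move=> c; ring.
rewrite (le_trans (ler_normB _ _))//.
have -> : s2 i * (2 * C * delta) = s2 i * (C * delta) + C * delta * s2 i by ring.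
rewrite lerD//.
  rewrite normrM (ger0_norm (s2_ge0 i)) ler_wpM2l// (le_trans (wmean_norm _ _))//.
  rewrite -[leRHS](wmean_cst p_sum1) wmean_le// => c.
  rewrite (le_trans (Cf' _ _))// ler_wpM2l// /W' opprB addrC subrK.
  exact: xi_bound.
rewrite (le_trans (wmean_norm _ _))// -wmeanZ wmean_le// => c.
have := taylor1_lipschitz (W' i c) (xi i c) df Cf'.
rewrite normrM [W' i c + _]subrK => h.
have -> : C * delta * xi i c ^+ 2 = delta * (C * xi i c ^+ 2) by ring.
exact: ler_pM.
Qed.

End stein_independent_sum.

(** * Ranks of the drawn cards *)

Section rank.
Context {n : nat}.
Implicit Types (D : {set 'I_n}) (a : nat).

Definition rank_in D a : nat := #|[set j in D | (j < a)%N]%SET|.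

Lemma rank_in_mono D a b : (a <= b)%N -> (rank_in D a <= rank_in D b)%N.
Proof.
move=> ab; apply/subset_leq_card/fintype.subsetP => j; rewrite !inE.
by case/andP=> -> /leq_trans; exact.
Qed.

Lemma rank_in_lt D (x : 'I_n) a : x \in D -> (x < a)%N ->
  (rank_in D x < rank_in D a)%N.
Proof.
move=> xD xa; apply/proper_card/fintype.properP; split.
  apply/fintype.subsetP => j; rewrite !inE => /andP[-> jx]/=.
  exact: ltn_trans xa.
by exists x; rewrite !inE ?xD ?ltnn// xa.
Qed.

Lemma rank_in_lt_card D (x : 'I_n) : x \in D -> (rank_in D x < #|D|)%N.
Proof.
move=> xD; apply/proper_card/fintype.properP; split.
  by apply/fintype.subsetP => j; rewrite !inE => /andP[].
by exists x; rewrite // !inE ltnn andbF.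
Qed.

Lemma rank_in_inj D : {in D &, injective (fun x : 'I_n => rank_in D x)}.
Proof.
move=> x y xD yD e; apply/val_inj; case: (ltngtP x y) => // xy.
  by have := rank_in_lt xD xy; rewrite /= e ltnn.
by have := rank_in_lt yD xy; rewrite /= e ltnn.
Qed.

(** On [D], the rank is a bijection onto the ordinals below [#|D|]. *)
Lemma card_rank_in_gt D j :
  #|[set x in D | (j < rank_in D x)%N]%SET| = (#|D| - j.+1)%N.
Proof.
have [/eqP D0|[x0 x0D]] := set_0Vmem D.
  rewrite (eqP D0) cards0 sub0n; apply/eqP; rewrite cards_eq0.
  by apply/eqP/setP => x; rewrite !inE.
have : (0 < #|D|)%N by rewrite (cardD1 x0) x0D.
move mE : #|D| => [//|m] _.
pose f (x : 'I_n) : 'I_m.+1 := inord (rank_in D x).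
have fE x : x \in D -> f x = rank_in D x :> nat.
  by move=> xD; rewrite inordK// -mE rank_in_lt_card.
have fI : {in D &, injective f}.
  move=> x y xD yD /(congr1 val) /=; rewrite !fE//; exact: rank_in_inj.
have fT : (f @: D = [set: 'I_m.+1])%SET.
  apply/eqP; rewrite eqEcard finset.subsetT/= cardsT card_ord card_in_imset// mE.
  by [].
transitivity #|[set i : 'I_m.+1 | (j < i)%N]%SET|.
  rewrite -(card_in_imset (f := f)); last first.
    by move=> x y /[!inE]/andP[xD _] /andP[yD _]; exact: fI.
  apply: eq_card => i; rewrite !inE; apply/imsetP/idP.
    by move=> [x /[!inE]/andP[xD xj] ->]; rewrite fE.
  have : i \in (f @: D)%SET by rewrite fT inE.
  by move=> /imsetP[x xD ->]; rewrite fE// => xj; exists x; rewrite // inE xD.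
rewrite -sum1dep_card big_mkcond /=; elim: m.+1 {mE f fE fI fT} => [|m' IH].
  by rewrite big_ord0.
by rewrite big_ord_recr/= IH; case: ltnP => ?; lia.
Qed.

End rank.

Section kcm_ranks.
Context {R : realType} {n k : nat}.
Hypothesis k_gt0 : (0 < k)%N.
Implicit Types (c : draws n k) (t : 'I_n) (h : nat -> R).

(** The mean of [h] at the minimum of [k] independent uniform variables on
  [{0, ..., m - 1}], by summation by parts: the minimum exceeds [j] with
  probability [((m - j.+1) / m) ^ k]. *)
Definition minrank_mean k m h : R :=
  h 0%N + \sum_(j < m.-1) (h j.+1 - h j) * ((m - j.+1)%:R / m%:R) ^+ k.

Lemma minrank_mean1 m : minrank_mean k m (fun=> 1) = 1.
Proof. by rewrite /minrank_mean big1 ?addr0// => j _; rewrite subrr mul0r. Qed.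

Definition row_min (r : {ffun 'I_k -> 'I_n}) : nat := \big[minn/n]_(i < k) (r i : nat).

Lemma row_minP r : exists i, row_min r = r i.
Proof.
have [i _ e] := eq_bigmin (Ordinal k_gt0) predT (fun i => r i : nat) isT
  (fun i _ => ltnW (ltn_ord (r i))).
by exists i.
Qed.

Lemma row_min_le r i : (row_min r <= r i)%N.
Proof.
rewrite /row_min; have : i \in index_enum 'I_k by rewrite mem_index_enum.
elim: (index_enum _) => //= j s IH; rewrite inE big_cons geq_min.
by case/predU1P => [->|/IH ->]; rewrite ?leqnn ?orbT.
Qed.

Lemma telescope_step h x m : (x < m)%N ->
  h x = h 0%N + \sum_(j < m.-1) (h j.+1 - h j) * (j < x)%:R.
Proof.
case: m => // m; rewrite ltnS /= => xm.
rewrite -(big_mkord predT (fun j => (h j.+1 - h j) * (j < x)%:R)).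
have z : \sum_(x <= j < m) (h j.+1 - h j) * (j < x)%:R = 0.
  rewrite big_nat_cond big1// => j; rewrite andbT => /andP[xj _].
  by rewrite ltnNge xj mulr0.
rewrite (big_cat_nat (leq0n x) xm)/= z addr0.
rewrite (@eq_big_nat _ _ _ 0%N x _ (fun j => h j.+1 - h j)) => [|j /andP[_ ->]].
  by rewrite telescope_sumr// subrKC.
by rewrite mulr1.
Qed.

(** The minimum of a row has rank greater than [j] if and only if all its
  entries do, and these are independent. *)
Lemma row_mean (D : {set 'I_n}) h : (0 < #|D|)%N ->
  \sum_(r : {ffun 'I_k -> 'I_n})
    (\prod_(i < k) ((r i \in D)%:R / #|D|%:R)) * h (rank_in D (row_min r)) =
  minrank_mean k #|D| h.
Proof.
move=> D0; pose m := #|D|.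
pose w (r : {ffun 'I_k -> 'I_n}) : R := \prod_(i < k) ((r i \in D)%:R / m%:R).
have sum_w : \sum_r w r = 1.
  rewrite -(bigA_distr_bigA (fun (i : 'I_k) (j : 'I_n) => (j \in D)%:R / m%:R)).
  rewrite big1// => i _.
  rewrite -mulr_suml -natr_sum -big_mkcond/= sum1_card divff//.
  by rewrite pnatr_eq0 -lt0n.
have tail j : \sum_r w r * (j < rank_in D (row_min r))%:R =
    ((m - j.+1)%:R / m%:R) ^+ k.
  transitivity (\sum_(r : {ffun 'I_k -> 'I_n}) \prod_(i < k)
      (((r i \in D) && (j < rank_in D (r i)))%N%:R / m%:R : R)).
    apply: eq_bigr => r _.
    have -> : (j < rank_in D (row_min r))%:R =
        \prod_(i < k) (j < rank_in D (r i))%:R :> R.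
      case: (ltnP j (rank_in D (row_min r))) => jr.
        rewrite big1// => i _; case: ltnP => //.
        by rewrite leqNgt (leq_trans jr)// rank_in_mono// row_min_le.
      have [i e] := row_minP r; rewrite (bigD1 i)//= -e.
      by rewrite ltnNge jr mul0r.
    rewrite /w -big_split; apply: eq_bigr => i _ /=.
    by rewrite -mulnb natrM mulrAC.
  rewrite -(bigA_distr_bigA (fun (i : 'I_k) (x : 'I_n) =>
    ((x \in D) && (j < rank_in D x))%N%:R / m%:R)).
  rewrite prodr_const card_ord; congr (_ ^+ _).
  rewrite -mulr_suml -natr_sum -big_mkcond/= sum1dep_card.
  by rewrite card_rank_in_gt.
transitivity (\sum_r w r * (h 0%N + \sum_(j < m.-1)
    (h j.+1 - h j) * (j < rank_in D (row_min r))%:R)).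
  apply: eq_bigr => r _.
  have [wr0|wr0] := eqVneq (w r) 0; first by rewrite -/(w r) wr0 !mul0r.
  congr (_ * _); apply: telescope_step.
  have [i ->] := row_minP r; apply: rank_in_lt_card.
  apply: contra_neqT wr0 => riD; rewrite /w (bigD1 i)//=.
  by rewrite (negbTE riD) !mul0r.
under eq_bigr do rewrite mulrDr.
rewrite big_split/= -mulr_suml sum_w mul1r; congr (_ + _).
under eq_bigr do rewrite mulr_sumr.
rewrite exchange_big/=; apply: eq_bigr => j _.
rewrite -tail mulr_sumr; apply: eq_bigr => r _; ring.
Qed.

Definition kcm_rank c t : nat := rank_in (kcm_deck c t) (kcm_sigma c t).

Lemma kcm_rank_le c t : (kcm_rank c t <= n)%N.
Proof. by rewrite -[leqRHS]card_ord max_card. Qed.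

Definition row_weight c t : R :=
  \prod_(i < k) ((c t i \in kcm_deck c t)%:R / #|kcm_deck c t|%:R).

Lemma kcm_pmfE c : kcm_pmf R c = \prod_(t < n) row_weight c t.
Proof. by []. Qed.

Lemma kcm_sigmaE c t : kcm_sigma c t = row_min (c t).
Proof. by []. Qed.

Lemma row_weight_neq0 c t : row_weight c t != 0 ->
  forall i, c t i \in kcm_deck c t.
Proof.
move=> w0 i; apply: contra_neqT w0 => ciD; rewrite /row_weight (bigD1 i)//=.
by rewrite (negbTE ciD) !mul0r.
Qed.

Lemma card_kcm_deck c m : (m <= n)%N ->
  (forall t, (t < m)%N -> row_weight c t != 0) -> #|kcm_deck c m| = (n - m)%N.
Proof.
elim: m => [_ _|m IH mn w0]; first by rewrite kcm_deck0 cardsT card_ord subn0.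
have {}IH := IH (ltnW mn) (fun t tm => w0 t (ltnW tm)).
have [i e] := row_minP (c (Ordinal mn)).
have := cardsD1 (c (Ordinal mn) i) (kcm_deck c m).
rewrite IH (row_weight_neq0 (w0 (Ordinal mn) (ltnSn m)) i) /=.
rewrite (kcm_deckS c (Ordinal mn)) /= => h.
have -> : [set j : 'I_n | kcm_sigma c (Ordinal mn) == j]%SET =
    [set c (Ordinal mn) i]%SET.
  by apply/setP => j; rewrite !inE kcm_sigmaE e eq_sym.
by rewrite subnS h.
Qed.

Lemma kcm_rank_set (m : 'I_n) c r t : (t < m)%N ->
  kcm_rank (kcm_set m c r) t = kcm_rank c t.
Proof.
move=> tm; rewrite /kcm_rank kcm_deck_set ?(ltnW tm)// !kcm_sigmaE ffunE.
by rewrite (_ : (t == m) = false)//; apply/eqP => e; rewrite e ltnn in tm.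
Qed.

Lemma row_weight_set (m : 'I_n) c r t : (t < m)%N ->
  row_weight (kcm_set m c r) t = row_weight c t.
Proof.
move=> tm; apply: eq_bigr => i _; rewrite kcm_deck_set ?(ltnW tm)// ffunE.
by rewrite (_ : (t == m) = false)//; apply/eqP => e; rewrite e ltnn in tm.
Qed.

(** Resampling row [m] multiplies the product over the earlier rows by a factor
  that depends only on the size of the deck, which is [n - m] whatever the
  earlier rows, provided that their weight is non-zero. *)
Lemma wmean_prod_rank (h : 'I_n -> nat -> R) :
  wmean (kcm_pmf R) (fun c : draws n k => \prod_t h t (kcm_rank c t)) =
  \prod_(t < n) minrank_mean k (n - t) (h t).
Proof.
have [n0|n0] := posnP n.
  have I0 (t : 'I_n) : False.
    by have := leq_trans (ltn_ord t) (eq_leq n0); rewrite ltn0.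
  rewrite big1 => [|t]; last by case: (I0 t).
  rewrite -[RHS](wmean_cst (@sum_kcm_pmf n k R)); apply: eq_wmean => c.
  by rewrite big1// => t; case: (I0 t).
set N : R := #|{: {ffun 'I_k -> 'I_n}}|%:R.
have N0 : N != 0 by rewrite pnatr_eq0 -lt0n card_ffun !card_ord expn_gt0 n0.
pose a c t := row_weight c t * h t (kcm_rank c t).
suff H m : (m <= n)%N ->
    N ^+ m * \sum_(c : draws n k) \prod_(t < n | (t < m)%N) a c t =
    N ^+ n * \prod_(t < n | (t < m)%N) minrank_mean k (n - t) (h t).
  have /(mulfI (expf_neq0 n N0)) := H n (leqnn n).
  under eq_bigr => c _ do under eq_bigl => t do rewrite ltn_ord.
  under [in X in _ = X -> _]eq_bigl => t do rewrite ltn_ord.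
  move=> <-; apply: eq_bigr => c _; rewrite kcm_pmfE -big_split.
  by apply: eq_bigr.
elim: m => [_|m IH mn].
  under eq_bigr do rewrite big_pred0//.
  rewrite [in RHS]big_pred0// sumr_const expr0 mul1r mulr1.
  rewrite [LHS](_ : _ = #|{: draws n k}|%:R)//.
  by rewrite card_ffun card_ord natrX.
pose tm := Ordinal mn.
have split_last (F : 'I_n -> R) : \prod_(t < n | (t < m.+1)%N) F t =
    (\prod_(t < n | (t < m)%N) F t) * F tm.
  rewrite (bigD1 tm)//= mulrC; congr (_ * _); apply: eq_bigl => t.
  by rewrite ltnS ltn_neqAle -val_eqE andbC.
rewrite split_last mulrA -IH ?(ltnW mn)// exprSr -mulrA.
rewrite -(sum_kcm_resample tm) -!mulrA; congr (_ * _).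
rewrite mulr_suml; apply: eq_bigr => c _.
transitivity (\sum_r (\prod_(t < n | (t < m)%N) a c t) * a (kcm_set tm c r) tm).
  apply: eq_bigr => r _; rewrite split_last; congr (_ * _).
  by apply: eq_bigr => t tm'; rewrite /a row_weight_set// kcm_rank_set.
rewrite -mulr_sumr; have [->|p0] := eqVneq (\prod_(t < n | (t < m)%N) a c t) 0.
  by rewrite !mul0r.
congr (_ * _); have cD : #|kcm_deck c m| = (n - m)%N.
  apply: card_kcm_deck => [|t tm']; first exact: ltnW.
  apply: contra_neq p0 => w0; rewrite (bigD1 t)//= /a w0 !mul0r.
  by [].
rewrite -cD -row_mean ?cD ?subn_gt0//; apply: eq_bigr => r _; rewrite /a; congr (_ * _).
  rewrite /row_weight kcm_deck_set//= cD; apply: eq_bigr => i _.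
  by rewrite ffunE eqxx.
by rewrite /kcm_rank kcm_deck_set//= kcm_sigmaE ffunE eqxx.
Qed.

End kcm_ranks.

Section kcm_moments.
Context {R : realType} {n k : nat}.
Hypothesis k_gt0 : (0 < k)%N.
Implicit Types (c : draws n k) (t : 'I_n) (h G H : nat -> R).

(** The cards smaller than the card drawn at time [t] that are drawn later are
  the ones that are in the deck at time [t], since every card is drawn once. *)
Lemma inversions_sum_rank c : kcm_pmf R c != 0 ->
  inversions (kcm_sigma c) = (\sum_t kcm_rank c t)%N.
Proof.
move=> c0; have [sI sn] := kcm_sigma_perm k_gt0 c0.
pose s t : 'I_n := Ordinal (sn t).
have s_inj : injective s by move=> t u /(congr1 val) /sI.
rewrite /inversions -sum1_card (eq_bigl (fun q : 'I_n * 'I_n =>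
  (q.1 < q.2)%N && (kcm_sigma c q.2 < kcm_sigma c q.1)%N)); last first.
  by move=> q; rewrite inE.
rewrite -(pair_big_dep predT (fun t u : 'I_n =>
  (t < u)%N && (kcm_sigma c u < kcm_sigma c t)%N) (fun _ _ => 1%N))/=.
apply: eq_bigr => t _; rewrite sum1dep_card /kcm_rank /rank_in.
rewrite -(card_imset _ s_inj); apply: eq_card => j; rewrite !inE.
apply/imsetP/andP => [[u /[!inE]/andP[tu ut] ->]|[jD jt]].
  split=> //; apply/forallP => v; apply/implyP => vt.
  apply/eqP => e; have vu : v = u by exact: sI e.
  by move: (ltn_trans vt tu); rewrite vu ltnn.
have [s' _ s'K] := injF_bij s_inj; exists (s' j); last by rewrite s'K.
have ej : kcm_sigma c (s' j) = j by rewrite -[in RHS](s'K j).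
rewrite inE ej jt andbT ltn_neqAle; apply/andP; split.
  by apply: contraTneq jt => e; rewrite -ej -(val_inj e) ltnn.
rewrite leqNgt; apply/negP => vt; have /implyP := forallP jD (s' j).
by move/(_ vt); rewrite ej eqxx.
Qed.

Lemma wmean_rank t h : wmean (kcm_pmf R) (fun c : draws n k => h (kcm_rank c t)) =
  minrank_mean k (n - t) h.
Proof.
have := wmean_prod_rank k_gt0 (fun u => if u == t then h else (fun=> 1 : R)).
rewrite [in RHS](bigD1 t)//= eqxx [X in _ * X]big1 => [|u /negbTE->]; last first.
  exact: minrank_mean1.
rewrite mulr1 => <-; apply: eq_wmean => c; rewrite (bigD1 t)//= eqxx big1 ?mulr1//.
by move=> u /negbTE->.
Qed.

(** Once [H] is expanded over the values of the other ranks, each term is a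
  product over the ranks, in which only the factor of index [t] involves [G]. *)
Lemma wmean_rank_indep t G H :
  wmean (kcm_pmf R) (fun c : draws n k =>
    G (kcm_rank c t) * H (\sum_(u | u != t) kcm_rank c u)%N) =
  wmean (kcm_pmf R) (fun c : draws n k => G (kcm_rank c t)) *
  wmean (kcm_pmf R) (fun c : draws n k => H (\sum_(u | u != t) kcm_rank c u)%N).
Proof.
pose ev (y : {ffun 'I_n -> 'I_n.+1}) G u (a : nat) : R :=
  if u == t then G a else (a == y u)%:R.
pose tot (y : {ffun 'I_n -> 'I_n.+1}) := (\sum_(u | u != t) y u)%N.
(* [y] lists the values of the other ranks; its value at [t] is a dummy 0 *)
have expand G' c : G' (kcm_rank c t) * H (\sum_(u | u != t) kcm_rank c u)%N =
    \sum_(y : {ffun 'I_n -> 'I_n.+1} | y t == ord0)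
      H (tot y) * \prod_u ev y G' u (kcm_rank c u).
  pose y0 : {ffun 'I_n -> 'I_n.+1} :=
    [ffun u => if u == t then ord0 else inord (kcm_rank c u)].
  have y0E u : u != t -> y0 u = kcm_rank c u :> nat.
    by move=> /negbTE ut; rewrite ffunE ut inordK// ltnS kcm_rank_le.
  rewrite (bigD1 y0)/=; last by rewrite ffunE eqxx.
  rewrite [X in _ + X]big1 ?addr0 => [|y /andP[/eqP yt yy0]].
    rewrite mulrC; congr (H _ * _).
      by apply: eq_bigr => u ut; apply/esym/y0E.
    rewrite (bigD1 t)//= /ev eqxx big1 ?mulr1// => u ut.
    by rewrite (negbTE ut) y0E// eqxx.
  have [u ut yu] : exists2 u, u != t & y u != kcm_rank c u :> nat.
    apply: contrapT => h; case/eqP: yy0; apply/ffunP => u; apply/val_inj => /=.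
    have [->|ut] := eqVneq u t; first by rewrite yt ffunE eqxx.
    rewrite y0E//; apply/eqP/negPn/negP => yu; by apply: h; exists u.
  by rewrite (bigD1 u)//= /ev (negbTE ut) eq_sym (negbTE yu) mul0r mulr0.
pose K := \sum_(y : {ffun 'I_n -> 'I_n.+1} | y t == ord0)
  H (tot y) * \prod_(u | u != t) minrank_mean k (n - u) (fun a => (a == y u)%:R).
have factor G' : wmean (kcm_pmf R) (fun c : draws n k =>
    G' (kcm_rank c t) * H (\sum_(u | u != t) kcm_rank c u)%N) =
    wmean (kcm_pmf R) (fun c : draws n k => G' (kcm_rank c t)) * K.
  rewrite (eq_wmean _ (expand G')) wmean_sum /K mulr_sumr; apply: eq_bigr => y _.
  rewrite wmeanZ wmean_prod_rank// (bigD1 t)//= wmean_rank mulrCA; congr (_ * (_ * _)).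
    by rewrite /ev eqxx.
  by apply: eq_bigr => u /negbTE ut; rewrite /ev ut.
rewrite factor; congr (_ * _).
have := factor (fun=> 1); rewrite (wmean_cst (@sum_kcm_pmf n k R)) mul1r => <-.
by apply: eq_wmean => c; rewrite mul1r.
Qed.

End kcm_moments.

(** * Mean and variance of the ranks *)

Section power_sums.
Context {R : realFieldType}.

Definition power_sum k m : R := \sum_(i < m) i%:R ^+ k.

Lemma power_sumS k m : power_sum k m.+1 = power_sum k m + m%:R ^+ k.
Proof. by rewrite /power_sum big_ord_recr. Qed.

(** The difference of powers factors as a sum of [k.+1] products of [k] factors
  [x] or [x + 1]. Summed over the integers, this bounds the power sums. *)
Lemma exprS_increment k (x : R) : 0 <= x ->
  k.+1%:R * x ^+ k <= (x + 1) ^+ k.+1 - x ^+ k.+1 <= k.+1%:R * (x + 1) ^+ k.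
Proof.
move=> x0; have x1 : x <= x + 1 by lra.
rewrite subrXX [x + 1 - x]addrAC subrr add0r mul1r.
have cst (y : R) : k.+1%:R * y = \sum_(i < k.+1) y.
  by rewrite sumr_const card_ord mulr_natl.
rewrite !cst; apply/andP; split; apply: ler_sum => i _.
  rewrite -[in leLHS](subnK (leq_ord i)) exprD ler_wpM2r ?exprn_ge0//.
  by rewrite lerXn2r// ?nnegrE//; lra.
rewrite -[in leRHS](subnK (leq_ord i)) exprD ler_wpM2l ?exprn_ge0//; first lra.
by rewrite lerXn2r// ?nnegrE//; lra.
Qed.

Lemma power_sum_ub k m : k.+1%:R * power_sum k m <= m%:R ^+ k.+1.
Proof.
elim: m => [|m IH]; first by rewrite /power_sum big_ord0 mulr0 expr0n.
rewrite power_sumS mulrDr -(natr1 m).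
have /andP[+ _] := exprS_increment k (ler0n R m); lra.
Qed.

Lemma power_sum_lb k m : (0 < k)%N ->
  m%:R ^+ k.+1 <= k.+1%:R * (power_sum k m + m%:R ^+ k).
Proof.
move=> k0; rewrite -power_sumS.
elim: m => [|m IH]; first by rewrite /power_sum big_ord1 !expr0n (gtn_eqF k0)/= mulr0.
rewrite power_sumS mulrDr -(natr1 m).
have /andP[_] := exprS_increment k (ler0n R m); lra.
Qed.

End power_sums.

Section minrank_moments.
Context {R : realType} (k : nat).
Hypothesis k_gt0 : (0 < k)%N.

Definition rank_mean m : R := minrank_mean k m (fun j => j%:R).

Definition rank_var m : R :=
  minrank_mean k m (fun j => j%:R ^+ 2) - rank_mean m ^+ 2.

Lemma minrank_mean_rev m (h : nat -> R) : (0 < m)%N ->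
  minrank_mean k m h * m%:R ^+ k =
  h 0%N * m%:R ^+ k + \sum_(i < m) (h (m - i)%N - h (m - i).-1) * i%:R ^+ k.
Proof.
case: m => // m _; rewrite /minrank_mean mulrDl; congr (_ + _).
rewrite big_ord_recl/= expr0n gtn_eqF// mulr0 add0r mulr_suml.
rewrite (reindex_inj rev_ord_inj)/=; apply: eq_bigr => i _.
have im := ltn_ord i.
have -> : (m - i.+1).+1 = (m.+1 - bump 0 i)%N by rewrite /bump /=; lia.
have -> : (m - i.+1)%N = (m.+1 - bump 0 i).-1 by rewrite /bump /=; lia.
have -> : (m.+1 - (m.+1 - bump 0 i))%N = bump 0 i by rewrite /bump /=; lia.
by rewrite expr_div_n -mulrA divfK// expf_neq0// pnatr_eq0.
Qed.

Lemma rank_meanE m : (0 < m)%N -> rank_mean m * m%:R ^+ k = power_sum k m.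
Proof.
move=> m0; rewrite /rank_mean minrank_mean_rev// mul0r add0r.
apply: eq_bigr => i _; rewrite -[RHS]mul1r; congr (_ * _).
have im := ltn_ord i; have -> : (m - i = (m - i).-1.+1)%N by lia.
by rewrite -natr1 /= addrAC subrr add0r.
Qed.

Lemma rank_sqr_meanE m : (0 < m)%N ->
  minrank_mean k m (fun j => j%:R ^+ 2 : R) * m%:R ^+ k =
  (2 * m%:R - 1) * power_sum k m - 2 * power_sum k.+1 m.
Proof.
move=> m0; rewrite minrank_mean_rev// expr0n mul0r add0r.
rewrite !mulr_sumr -sumrB; apply: eq_bigr => i _.
have [d e] : exists d, (m - i = d.+1)%N.
  by exists (m - i).-1; have := ltn_ord i; lia.
have -> : m%:R = d%:R + 1 + i%:R :> R by rewrite natr1 -e -natrD subnK// ltnW.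
rewrite e -natr1 /= [i%:R ^+ k.+1]exprS; ring.
Qed.

Let K : R := k%:R.
Let K1 : 1 <= K. Proof. by rewrite /K ler1n. Qed.

Lemma rank_mean_bounds m : (0 < m)%N ->
  m%:R / (K + 1) - 1 <= rank_mean m <= m%:R / (K + 1).
Proof.
move=> m0; have mk : 0 < m%:R ^+ k :> R by rewrite exprn_gt0// ltr0n.
have := power_sum_ub (R := R) k m; have := power_sum_lb (R := R) m k_gt0.
rewrite -rank_meanE// -[k.+1%:R]natr1 -/K exprS.
have -> : (K + 1) * (rank_mean m * m%:R ^+ k + m%:R ^+ k) =
  ((K + 1) * (rank_mean m + 1)) * m%:R ^+ k by ring.
rewrite mulrA !ler_pM2r// => h1 h2.
have K0 : 0 < K + 1 by have := K1; lra.
rewrite lerBlDr ler_pdivrMr// ler_pdivlMr//.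
by rewrite [_ * (K + 1)]mulrC [rank_mean m * _]mulrC h1 h2.
Qed.

Lemma rank_sqr_mean_bounds m : (0 < m)%N ->
  `|minrank_mean k m (fun j => j%:R ^+ 2) -
    2 / ((K + 1) * (K + 2)) * m%:R ^+ 2| <= 3 * m%:R.
Proof.
move=> m0; have m1 : 1 <= m%:R :> R by rewrite ler1n.
set q := minrank_mean _ _ _; set x : R := m%:R in m1 *.
have xk : 0 < x ^+ k by rewrite exprn_gt0//; lra.
have [lb ub] := andP (rank_mean_bounds m0).
rewrite -/x in lb ub.
have K0 : 0 < K + 2 by have := K1; lra.
have K01 : 0 < K + 1 by have := K1; lra.
pose s := power_sum k.+1 m / x ^+ k.
have sE : power_sum k.+1 m = s * x ^+ k by rewrite divfK// gt_eqF.
have qE : q = (2 * x - 1) * rank_mean m - 2 * s.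
  apply: (mulIf (lt0r_neq0 xk)); rewrite rank_sqr_meanE// -rank_meanE// sE -/x.
  by ring.
have k2E : k.+2%:R = K + 2 :> R by rewrite -addn2 natrD.
have s_ub : s <= x ^+ 2 / (K + 2).
  rewrite ler_pdivlMr// -(ler_pM2r xk) -exprD add2n.
  by have := power_sum_ub (R := R) k.+1 m; rewrite k2E sE mulrA [s * _]mulrC.
have s_lb : x ^+ 2 / (K + 2) - x <= s.
  rewrite lerBlDr ler_pdivrMr// -(ler_pM2r xk) -exprD add2n.
  have := power_sum_lb (R := R) m (ltn0Sn k); rewrite k2E sE [x ^+ k.+1]exprS.
  by rewrite -mulrDl mulrA [(s + x) * _]mulrC.
have e : 2 / ((K + 1) * (K + 2)) * x ^+ 2 =
    2 * x * (x / (K + 1)) - 2 * (x ^+ 2 / (K + 2)).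
  by field; rewrite !gt_eqF.
have y_ub : x / (K + 1) <= x / 2.
  by rewrite ler_pM2l ?lef_pV2 ?posrE//; have := K1; lra.
have y0 : 0 <= x / (K + 1) by rewrite divr_ge0//; lra.
rewrite qE e; move: (x / (K + 1)) (x ^+ 2 / (K + 2)) lb ub s_ub s_lb y_ub y0 => y z.
move=> lb ub s_ub s_lb y_ub y0.
rewrite ler_norml; apply/andP; split; nra.
Qed.

Lemma rank_mean_ge0 m : (0 < m)%N -> 0 <= rank_mean m.
Proof.
move=> m0; have mk : 0 < m%:R ^+ k :> R by rewrite exprn_gt0// ltr0n.
by rewrite -(pmulr_lge0 _ mk) rank_meanE// sumr_ge0.
Qed.

(** The leading coefficient of the variance, [2 / ((k + 1) * (k + 2))] for the
  second moment minus [1 / (k + 1) ^ 2] for the squared mean, is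
  [3 * kcm_b R k]; the factor 3 is lost in the sum of the squares up to [n]. *)
Lemma rank_var_bounds m : (0 < m)%N ->
  `|rank_var m - 3 * kcm_b R k * m%:R ^+ 2| <= 5 * m%:R.
Proof.
move=> m0; have := rank_sqr_mean_bounds m0; rewrite /rank_var.
set q := minrank_mean _ _ _; have mu0 := rank_mean_ge0 m0.
have [lb ub] := andP (rank_mean_bounds m0).
have K0 : 0 < K + 2 by have := K1; lra.
have K01 : 0 < K + 1 by have := K1; lra.
have m1 : 1 <= m%:R :> R by rewrite ler1n.
have -> : 3 * kcm_b R k * m%:R ^+ 2 = 2 / ((K + 1) * (K + 2)) * m%:R ^+ 2 -
    (m%:R / (K + 1)) ^+ 2.
  by rewrite /kcm_b -/K; field; rewrite !gt_eqF.
have y_ub : m%:R / (K + 1) <= m%:R / 2.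
  by rewrite ler_pM2l ?lef_pV2 ?posrE//; have := K1; lra.
move: (2 / _ * _) (m%:R / (K + 1)) lb ub y_ub => z y lb ub y_ub.
rewrite !ler_norml => /andP[h1 h2]; apply/andP; split; nra.
Qed.

Lemma kcm_b_gt0 : 0 < kcm_b R k.
Proof.
have := K1; rewrite /kcm_b -/K => h.
by rewrite divr_gt0 ?mulr_gt0 ?exprn_gt0//; lra.
Qed.

Lemma kcm_b_le : 3 * kcm_b R k <= 1.
Proof.
have := K1; rewrite /kcm_b -/K => h; rewrite mulrA ler_pdivrMr; first nra.
by rewrite ?mulr_gt0 ?exprn_gt0//; lra.
Qed.

(** The increments of the sum and of its approximation differ by a bounded
  amount. *)
Lemma sum_rank_mean_bounds n :
  `|\sum_(m < n) rank_mean m.+1 - kcm_a R k * n%:R ^+ 2| <= 2 * n%:R.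
Proof.
elim: n => [|n IH]; first by rewrite big_ord0 expr0n !mulr0 subrr normr0.
rewrite big_ord_recr/= -!(natr1 n).
have := rank_mean_bounds (ltn0Sn n); rewrite -(natr1 n) => /andP[lb ub].
have K01 : 0 < K + 1 by have := K1; lra.
have e : kcm_a R k * (n%:R + 1) ^+ 2 =
    kcm_a R k * n%:R ^+ 2 + (n%:R + 1) / (K + 1) - kcm_a R k.
  by rewrite /kcm_a -/K; field; rewrite gt_eqF.
have a0 : 0 <= kcm_a R k by rewrite /kcm_a -/K invr_ge0; lra.
have a1 : kcm_a R k <= 1.
  by have := K1; rewrite /kcm_a -/K => h; rewrite invf_le1; lra.
rewrite e; move: IH; rewrite !ler_norml => /andP[? ?]; apply/andP; split; lra.
Qed.

Lemma sum_rank_var_bounds n :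
  `|\sum_(m < n) rank_var m.+1 - kcm_b R k * n%:R ^+ 3| <= 6 * n%:R ^+ 2.
Proof.
elim: n => [|n IH]; first by rewrite big_ord0 !expr0n !mulr0 subrr normr0.
rewrite big_ord_recr/= -!(natr1 n).
have := rank_var_bounds (ltn0Sn n); rewrite -!(natr1 n).
have := kcm_b_gt0; have := kcm_b_le; have : 0 <= n%:R :> R by [].
move: IH; move: (\sum_(_ < _) _) (rank_var _) (kcm_b _ _) (n%:R : R) => S v b x.
rewrite !ler_norml => /andP[h1 h2] x0 b1 b0 /andP[h3 h4].
have bx : 3 * (b * x) <= x by nra.
have bx0 : 0 <= b * x by nra.
have e3 : b * (x + 1) ^+ 3 = b * x ^+ 3 + 3 * (b * x ^+ 2) + 3 * (b * x) + b by ring.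
have e2 : 3 * b * (x + 1) ^+ 2 = 3 * (b * x ^+ 2) + 6 * (b * x) + 3 * b by ring.
have e1 : (x + 1) ^+ 2 = x ^+ 2 + 2 * x + 1 by ring.
rewrite e2 in h3 h4; rewrite e3 e1; apply/andP; split; lra.
Qed.

End minrank_moments.

(** * Mean and variance of the number of inversions *)

Section kcm_prob_wmean.
Context {R : realType} {n k : nat}.
Implicit Types (f : draws n k -> R).
Local Notation P := (kcm_prob R n k).

Lemma kcm_prob1 (c : draws n k) : P [set c] = (kcm_pmf R c)%:E.
Proof. by rewrite /kcm_prob fsbig_set1. Qed.

Lemma kcm_expectation f : ('E_P[f] = (wmean (kcm_pmf R) f)%:E)%E.
Proof.
have fE : EFin \o f = fun c =>
    (\sum_(a : draws n k) (f a)%:E * (\1_[set a] c)%:E)%E.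
  apply/funext => c /=; rewrite (bigD1 c)//= indicE mem_set// mule1.
  rewrite big1 ?adde0// => a ac; rewrite indicE memNset ?mule0// => /= ca.
  by rewrite ca eqxx in ac.
have iP (a : draws n k) : P.-integrable [set: draws n k] (EFin \o \1_[set a]).
  exact: integrable_indic.
rewrite unlock -[X in integral _ _ X]/(EFin \o f) fE integral_sum//; last first.
  by move=> a; apply: integrableZl => //; exact: iP.
rewrite /wmean -sumEFin; apply: eq_bigr => a _.
rewrite integralZl//; last exact: iP.
rewrite integral_indic// setIT; have := kcm_prob1 a; rewrite /= => ->.
by rewrite -EFinM mulrC.
Qed.

Lemma kcm_prob_wmean (A : set (draws n k)) :
  P A = (wmean (kcm_pmf R) \1_A)%:E.
Proof. by rewrite -kcm_expectation expectation_indic. Qed.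

Lemma kcm_cdf f (x : R) : cdf (kcm_RV f) x =
  (wmean (kcm_pmf R) (fun c => (f c <= x)%R%:R))%:E.
Proof.
rewrite /cdf /distribution /pushforward/= kcm_prob_wmean; congr (_%:E).
apply: eq_wmean => c; rewrite indicE; congr (_%:R); congr nat_of_bool.
by apply/idP/idP => [/set_mem|h]; [|apply/mem_set]; rewrite /= in_itv.
Qed.

Lemma kcm_inv_meanE : kcm_inv_mean R n k = wmean (kcm_pmf R) (@kcm_inv n k R).
Proof. by rewrite /kcm_inv_mean kcm_expectation. Qed.

Lemma kcm_inv_varE : kcm_inv_var R n k =
  wmean (kcm_pmf R) (fun c : draws n k => (kcm_inv R c - kcm_inv_mean R n k) ^+ 2).
Proof.
rewrite /kcm_inv_var /variance covariance.unlock.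
rewrite [X in fine X](_ : _ = (wmean (kcm_pmf R)
  (fun c : draws n k => (kcm_inv R c - kcm_inv_mean R n k) ^+ 2))%:E)//.
by rewrite -kcm_expectation; congr ('E_P[_])%E; exact/funext.
Qed.

End kcm_prob_wmean.

Section kcm_inversions.
Context {R : realType} (k : nat).
Hypothesis k_gt0 : (0 < k)%N.

Definition kcm_mean n : R := \sum_(m < n) rank_mean k m.+1.

Definition kcm_var n : R := \sum_(m < n) rank_var k m.+1.

Lemma sum_rev n (F : nat -> R) : \sum_(t < n) F (n - t)%N = \sum_(m < n) F m.+1.
Proof.
rewrite (reindex_inj rev_ord_inj)/=; apply: eq_bigr => m _; congr F.
by have := ltn_ord m; lia.
Qed.

Section fixed_size.
Variables (n : nat) (s : R).
Implicit Types (c : draws n k) (t : 'I_n).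

Definition std_rank t c : R := ((kcm_rank c t)%:R - rank_mean k (n - t)) / s.

Lemma std_rank_indep t (G H : R -> R) :
  wmean (kcm_pmf R) (fun c => G (std_rank t c) *
    H (\sum_u std_rank u c - std_rank t c)) =
  wmean (kcm_pmf R) (fun c => G (std_rank t c)) *
  wmean (kcm_pmf R) (fun c => H (\sum_u std_rank u c - std_rank t c)).
Proof.
pose a : R := \sum_(u | u != t) rank_mean k (n - u).
have restE c : \sum_u std_rank u c - std_rank t c =
    ((\sum_(u | u != t) kcm_rank c u)%N%:R - a) / s.
  rewrite (bigD1 t)//= [X in X - _]addrC addrK -mulr_suml; congr (_ / _).
  by rewrite sumrB natr_sum.
under eq_wmean do rewrite restE.
under [X in _ = _ * X]eq_wmean do rewrite restE.
exact: (wmean_rank_indep k_gt0 t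
  (fun j => G ((j%:R - rank_mean k (n - t)) / s)) (fun j => H ((j%:R - a) / s))).
Qed.

Lemma std_rank_mean0 t : wmean (kcm_pmf R) (std_rank t) = 0.
Proof.
rewrite (@eq_wmean _ _ _ _ (fun c => s^-1 *
  ((kcm_rank c t)%:R - rank_mean k (n - t)))) => [|c]; last exact: mulrC.
rewrite wmeanZ wmeanB (wmean_cst (@sum_kcm_pmf n k R)).
by rewrite (wmean_rank k_gt0 t (fun j => j%:R)) subrr mulr0.
Qed.

Lemma std_rank_var t : wmean (kcm_pmf R) (fun c => std_rank t c ^+ 2) =
  rank_var k (n - t) / s ^+ 2.
Proof.
set mu := rank_mean k (n - t) : R.
rewrite (@eq_wmean _ _ _ _ (fun c => (s ^+ 2)^-1 *
  ((kcm_rank c t)%:R ^+ 2 - (2 * mu) * (kcm_rank c t)%:R + mu ^+ 2))); last first.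
  by move=> c; rewrite /std_rank -/mu expr_div_n; ring.
rewrite wmeanZ wmeanD wmeanB wmeanZ (wmean_cst (@sum_kcm_pmf n k R)).
rewrite (wmean_rank k_gt0 t (fun j => j%:R)) (wmean_rank k_gt0 t (fun j => j%:R ^+ 2)).
by rewrite /rank_var -/(rank_mean k (n - t)) -/mu; ring.
Qed.

Lemma std_rank_bound t c : 0 <= s -> `|std_rank t c| <= n%:R / s.
Proof.
move=> s0; rewrite normrM [`|s^-1|]ger0_norm ?invr_ge0// ler_wpM2r ?invr_ge0//.
have nt : (0 < n - t)%N by rewrite subn_gt0.
have := rank_mean_ge0 k_gt0 nt (R := R).
have /andP[_] := rank_mean_bounds k_gt0 nt (R := R).
have : (n - t)%:R / (k%:R + 1) <= n%:R :> R.
  rewrite ler_pdivrMr ?ltr_wpDl// (@le_trans _ _ n%:R) ?ler_nat ?leq_subr//.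
  by rewrite ler_peMr// lerDr.
have : (kcm_rank c t)%:R <= n%:R :> R by rewrite ler_nat kcm_rank_le.
have := ler0n R (kcm_rank c t).
by rewrite ler_norml => *; apply/andP; split; lra.
Qed.

Lemma sum_std_rank c :
  \sum_t std_rank t c = ((\sum_t kcm_rank c t)%N%:R - kcm_mean n) / s.
Proof. by rewrite -mulr_suml sumrB natr_sum (sum_rev n (rank_mean k)). Qed.

Lemma sum_std_rank_var :
  wmean (kcm_pmf R) (fun c => (\sum_t std_rank t c) ^+ 2) = kcm_var n / s ^+ 2.
Proof.
rewrite (wmean_sum_sqr std_rank_indep std_rank_mean0).
under eq_bigr do rewrite std_rank_var.
by rewrite -mulr_suml (sum_rev n (rank_var k)).
Qed.

End fixed_size.

(** The number of inversions is the sum of the ranks wherever the weight is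
  non-zero. *)
Lemma wmean_inv n (h : R -> R) : wmean (kcm_pmf R) (fun c : draws n k => h (kcm_inv R c)) =
  wmean (kcm_pmf R) (fun c : draws n k => h (\sum_t kcm_rank c t)%N%:R).
Proof.
apply: eq_bigr => c _; have [->|c0] := eqVneq (kcm_pmf R c) 0.
  by rewrite !mul0r.
by rewrite /kcm_inv (inversions_sum_rank k_gt0 c0).
Qed.

Lemma kcm_inv_mean_sum n : kcm_inv_mean R n k = kcm_mean n.
Proof.
rewrite kcm_inv_meanE (wmean_inv n id).
have : wmean (kcm_pmf R) (fun c : draws n k => \sum_t std_rank 1 t c) = 0.
  by rewrite wmean_sum big1// => t _; exact: std_rank_mean0.
under eq_wmean do rewrite sum_std_rank divr1.
rewrite wmeanB (wmean_cst (@sum_kcm_pmf n k R)).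
by move/eqP; rewrite subr_eq0 => /eqP.
Qed.

Lemma kcm_inv_var_sum n : kcm_inv_var R n k = kcm_var n.
Proof.
rewrite kcm_inv_varE kcm_inv_mean_sum (wmean_inv n (fun x => (x - kcm_mean n) ^+ 2)).
have := sum_std_rank_var n 1; rewrite expr1n divr1 => <-.
by apply: eq_wmean => c; rewrite sum_std_rank divr1.
Qed.

End kcm_inversions.

(** * The limit theorem *)

Section kcm_limit.
Context {R : realType} (k : nat).
Hypothesis k_gt0 : (0 < k)%N.
Local Notation b := (kcm_b R k).
Local Notation V := (@kcm_var R k).

Definition kcm_scale (n : nat) : R := Num.sqrt b * n%:R `^ (3 / 2).

Lemma kcm_scale_ge0 n : 0 <= kcm_scale n.
Proof. by rewrite mulr_ge0// powR_ge0. Qed.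

Lemma kcm_scale_sqr n : kcm_scale n ^+ 2 = b * n%:R ^+ 3.
Proof.
rewrite exprMn sqr_sqrtr ?ltW ?kcm_b_gt0//; congr (_ * _).
rewrite -[LHS]powR_mulrn ?powR_ge0// -powRrM -[RHS]powR_mulrn//; congr (_ `^ _).
by rewrite divfK.
Qed.

Lemma cvg_inv_nat : (n%:R^-1 : R) @[n --> \oo] --> 0.
Proof.
have pos : \forall n \near \oo, 0 < n%:R :> R.
  by near=> n; rewrite ltr0n; near: n; exact: nbhs_infty_gt.
by have [_ h] := gtr0_cvgV0 pos; apply: h; exact: cvgr_idn.
Unshelve. all: by end_near. Qed.

Lemma kcm_var_equiv : Num.sqrt (V n) / kcm_scale n @[n --> \oo] --> (1 : R).
Proof.
have b0 : 0 < b := kcm_b_gt0 k_gt0.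
have lim : V n / (b * n%:R ^+ 3) @[n --> \oo] --> (1 : R).
  apply/cvgrPdist_le => e e0; near=> n.
  have n0 : 0 < n%:R :> R by rewrite ltr0n; near: n; exact: nbhs_infty_gt.
  have bn0 : 0 < b * n%:R ^+ 3 by rewrite mulr_gt0// exprn_gt0.
  have -> : 1 - V n / (b * n%:R ^+ 3) = (b * n%:R ^+ 3)^-1 * (b * n%:R ^+ 3 - V n).
    by rewrite mulrBr mulVf ?gt_eqF// mulrC.
  rewrite normrM distrC gtr0_norm ?invr_gt0//.
  rewrite ler_pdivrMl//; apply: (le_trans (sum_rank_var_bounds k_gt0 n)).
  have : 6 / (e * b) <= n%:R by near: n; exact: nbhs_infty_ger.
  rewrite ler_pdivrMr ?(mulr_gt0 e0 b0)// => h.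
  have -> : b * n%:R ^+ 3 * e = (n%:R * (e * b)) * n%:R ^+ 2 by ring.
  by rewrite ler_wpM2r ?sqr_ge0.
have -> : (fun n => Num.sqrt (V n) / kcm_scale n) =
    (fun n => Num.sqrt (V n / (b * n%:R ^+ 3))).
  apply/funext => n; rewrite -kcm_scale_sqr -exprVn [in RHS]mulrC.
  by rewrite sqrtrM ?sqr_ge0// sqrtr_sqr ger0_norm ?invr_ge0 ?kcm_scale_ge0// mulrC.
rewrite -[X in _ --> X]sqrtr1; apply: (@continuous_cvg _ _ _ _ _ _ (@Num.sqrt R)) => //.
exact: sqrt_continuous.
Unshelve. all: by end_near. Qed.

Lemma cvg_nat_kcm_scale : n%:R / kcm_scale n @[n --> \oo] --> (0 : R).
Proof.
have b0 : 0 < b := kcm_b_gt0 k_gt0.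
have lim : Num.sqrt (b^-1 * n%:R^-1) @[n --> \oo] --> (0 : R).
  rewrite -[X in _ --> X]sqrtr0; 
  apply: (@continuous_cvg _ _ _ _ _ _ (@Num.sqrt R)); first exact: sqrt_continuous.
  rewrite -[X in _ --> X](mulr0 b^-1); apply: cvgM; first exact: cvg_cst.
  exact: cvg_inv_nat.
apply: cvg_trans lim; apply: near_eq_cvg; near=> n.
have n0 : 0 < n%:R :> R by rewrite ltr0n; near: n; exact: nbhs_infty_gt.
rewrite -[RHS]ger0_norm ?divr_ge0 ?kcm_scale_ge0// -sqrtr_sqr expr_div_n.
rewrite kcm_scale_sqr; congr Num.sqrt; field.
by rewrite !gt_eqF.
Unshelve. all: by end_near. Qed.

Lemma cvg_nat_sqrt_var : n%:R / Num.sqrt (V n) @[n --> \oo] --> (0 : R).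
Proof.
have lim : (n%:R / kcm_scale n) / (Num.sqrt (V n) / kcm_scale n) @[n --> \oo] -->
    (0 / 1 : R).
  by apply: cvgM cvg_nat_kcm_scale _; apply: cvgV kcm_var_equiv; rewrite oner_eq0.
rewrite mul0r in lim; apply: cvg_trans lim; apply: near_eq_cvg; near=> n.
have n0 : (0 < n)%N by near: n; exact: nbhs_infty_gt.
have s0 : kcm_scale n != 0.
  rewrite -sqrf_eq0 kcm_scale_sqr.
  by rewrite mulf_neq0 ?gt_eqF ?kcm_b_gt0// exprn_gt0 ?ltr0n.
by rewrite invf_div mulrA divfK.
Unshelve. all: by end_near. Qed.

Lemma kcm_var_gt0 : \forall n \near \oo, 0 < V n.
Proof.
have /cvgrPdist_lt/(_ 1 ltr01) h := kcm_var_equiv.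
near=> n; rewrite ltNge; apply/negP => V0.
have : `|1 - Num.sqrt (V n) / kcm_scale n| < 1 by near: n.
by rewrite (ler0_sqrtr V0) mul0r subr0 normr1 ltxx.
Unshelve. all: by end_near. Qed.

Lemma kcm_mean_equiv :
  (@kcm_mean R k n - kcm_a R k * n%:R ^+ 2) / kcm_scale n @[n --> \oo] --> (0 : R).
Proof.
have lim : 2 * (n%:R / kcm_scale n) @[n --> \oo] --> (0 : R).
  rewrite -[X in _ --> X](mulr0 2); apply: cvgM; first exact: cvg_cst.
  exact: cvg_nat_kcm_scale.
apply: norm_cvg0.
apply: (squeeze_cvgr _ (@cvg_cst _ (0 : R) _ _ _) lim).
near=> n; rewrite normr_ge0/= normrM [`|_^-1|]ger0_norm ?invr_ge0 ?kcm_scale_ge0//.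
by rewrite mulrA ler_wpM2r ?invr_ge0 ?kcm_scale_ge0// sum_rank_mean_bounds.
Unshelve. all: by end_near. Qed.

End kcm_limit.

Section kcm_clt.
Context {R : realType} (k : nat).
Hypothesis k_gt0 : (0 < k)%N.
Local Notation V := (@kcm_var R k).
Local Notation mean := (@kcm_mean R k).
Variables A S : nat -> R.
Hypothesis cvg_scale : Num.sqrt (V n) / S n @[n --> \oo] --> (1 : R).
Hypothesis cvg_shift : (mean n - A n) / S n @[n --> \oo] --> (0 : R).

Let pmf n := @kcm_pmf n k R.
Arguments pmf : clear implicits.
Let pmf_ge0 n c : 0 <= pmf n c. Proof. exact: kcm_pmf_ge0. Qed.
Let pmf_sum1 n : \sum_c pmf n c = 1. Proof. exact: sum_kcm_pmf. Qed.

Let W n (c : draws n k) : R := \sum_t std_rank (Num.sqrt (V n)) t c.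
Arguments W : clear implicits.
Let alpha n := Num.sqrt (V n) / S n.
Let beta n := (mean n - A n) / S n.
Let Y n (c : draws n k) : R := ((\sum_t kcm_rank c t)%N%:R - A n) / S n.
Arguments Y : clear implicits.

Let YE n c : 0 < V n -> Y n c = alpha n * W n c + beta n.
Proof.
move=> V0; rewrite /W sum_std_rank// /alpha /beta /Y.
rewrite [_ / _ * _]mulrC mulrA divfK; last by rewrite gt_eqF// sqrtr_gt0.
by rewrite -mulrDl addrA subrK.
Qed.

Let W0 n : wmean (pmf n) (W n) = 0.
Proof. by rewrite wmean_sum big1// => t _; exact: std_rank_mean0. Qed.

Let W2 n : 0 < V n -> wmean (pmf n) (fun c => W n c ^+ 2) = 1.
Proof.
by move=> V0; rewrite sum_std_rank_var// sqr_sqrtr ?ltW// divff// gt_eqF.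
Qed.

(* any bound on the second moments will do; [alpha n ^+ 2 + beta n ^+ 2 <= 5]
   once [alpha n] and [beta n] are within 1 of their limits *)
Let Y2 : \forall n \near \oo, wmean (pmf n) (fun c => Y n c ^+ 2) <= 5.
Proof.
have V0 := @kcm_var_gt0 R _ k_gt0.
have /cvgrPdist_le/(_ 1 ltr01) a1 := cvg_scale.
have /cvgrPdist_le/(_ 1 ltr01) b1 := cvg_shift.
near=> n.
have Vn : 0 < V n by near: n.
have -> : wmean (pmf n) (fun c => Y n c ^+ 2) = alpha n ^+ 2 + beta n ^+ 2.
  rewrite (@eq_wmean _ _ _ _ (fun c => alpha n ^+ 2 * W n c ^+ 2 +
    2 * alpha n * beta n * W n c + beta n ^+ 2)); last first.
    by move=> c; rewrite YE//; ring.
  by rewrite !wmeanD !wmeanZ W0 W2// (wmean_cst (pmf_sum1 n)) mulr0 addr0 mulr1.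
have : `|1 - alpha n| <= 1 by near: n.
have : `|0 - beta n| <= 1 by near: n.
by rewrite !ler_norml => /andP[? ?] /andP[? ?]; nra.
Unshelve. all: by end_near. Qed.

Let stein_W u L B D : lipschitz_const L u ->
  (forall x, `|u x| <= B) -> (forall x, D < `|x| -> u x = 0) ->
  gauss_mean u = 0 -> exists C, forall n, 0 < V n ->
  `|wmean (pmf n) (fun c => u (W n c))| <= 2 * C * (n%:R / Num.sqrt (V n)).
Proof.
move=> Lu uB u0 mu0; have [f [f' [C [df Cf' fu]]]] := stein_solution Lu uB u0 mu0.
exists C => n Vn; under eq_wmean do rewrite -fu.
apply: (stein_bound (@pmf_ge0 n) (pmf_sum1 n) _ _ _ _ df Cf').
- by move=> t G H; exact: std_rank_indep.
- by move=> t; exact: std_rank_mean0.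
- by move=> t c; apply: std_rank_bound.
- rewrite -wmean_sum_sqr; [exact: W2| |].
  + by move=> t G H; exact: std_rank_indep.
  + by move=> t; exact: std_rank_mean0.
Qed.

Let stein_Y u L B D : lipschitz_const L u ->
  (forall x, `|u x| <= B) -> (forall x, D < `|x| -> u x = 0) ->
  gauss_mean u = 0 -> wmean (pmf n) (fun c => u (Y n c)) @[n --> \oo] --> 0.
Proof.
move=> Lu uB u0 mu0; have [C WC] := stein_W Lu uB u0 mu0.
have L0 := lipschitz_const_ge0 Lu.
apply: norm_cvg0.
have lim : 2 * C * (n%:R / Num.sqrt (V n)) + L * (`|1 - alpha n| + `|beta n|)
    @[n --> \oo] --> (0 : R).
  have -> : (0 : R) = 2 * C * 0 + L * (`|1 - 1 : R| + `|0 : R|).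
    by rewrite subrr normr0 addr0 !mulr0 addr0.
  apply: cvgD; apply: cvgM; [exact: cvg_cst|exact: cvg_nat_sqrt_var|exact: cvg_cst|].
  apply: cvgD; apply: cvg_norm => //.
  by apply: cvgB => //; exact: cvg_cst.
apply: (squeeze_cvgr _ (@cvg_cst _ (0 : R) _ _ _) lim).
have V0 := @kcm_var_gt0 R _ k_gt0.
near=> n; rewrite normr_ge0/=.
have Vn : 0 < V n by near: n.
have -> : wmean (pmf n) (fun c => u (Y n c)) = wmean (pmf n) (fun c => u (W n c)) +
    wmean (pmf n) (fun c => u (Y n c) - u (W n c)).
  by rewrite wmeanB addrC subrK.
rewrite (le_trans (ler_normD _ _))// lerD ?WC//.
apply: (le_trans (wmean_norm (@pmf_ge0 n) _)).
(* [`|W| <= (1 + W ^+ 2) / 2] bounds the first absolute moment by 1 *)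
apply: (@le_trans _ _ (wmean (pmf n) (fun c =>
    L * (`|1 - alpha n| * ((1 + W n c ^+ 2) / 2) + `|beta n|)))).
  apply: wmean_le (@pmf_ge0 n) _ _ _ => c; rewrite (le_trans (Lu _ _))// ler_wpM2l//.
  rewrite YE//.
  have -> : alpha n * W n c + beta n - W n c = - ((1 - alpha n) * W n c) + beta n.
    by ring.
  rewrite (le_trans (ler_normD _ _))// lerD// normrN normrM ler_wpM2l//.
  have := sqr_ge0 (W n c + 1); have := sqr_ge0 (W n c - 1).
  move: (W n c) => w ? ?; rewrite ler_norml; apply/andP; split; nra.
rewrite wmeanZ wmeanD wmeanZ (wmean_cst (pmf_sum1 n)).
under eq_wmean do rewrite mulrC.
rewrite wmeanZ wmeanD W2// (wmean_cst (pmf_sum1 n)).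
by rewrite mulVf ?mulr1// pnatr_eq0.
Unshelve. all: by end_near. Qed.

(** The normalized number of inversions is [alpha n * W n + beta n] for the
  standardized sum [W n], with [alpha n] tending to 1 and [beta n] to 0. As
  [W n] has first absolute moment at most 1, this changes the mean of a test
  function of Lipschitz constant [L] by at most [L * (|1 - alpha n| + |beta n|)]. *)
Lemma kcm_clt (x : R) :
  {for x, continuous (fun y : R => gauss_mean \1_`]-oo, y])} ->
  wmean (pmf n) (fun c => ((kcm_inv R c - A n) / S n <= x)%R%:R) @[n --> \oo] -->
  (gauss_mean \1_`]-oo, x] : R).
Proof.
move=> cx; have := cvg_wmean_le (@pmf_ge0) pmf_sum1 Y2 stein_Y cx.
rewrite (_ : (fun n => wmean (pmf n) (fun c => (Y n c <= x)%R%:R)) =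
  (fun n => wmean (pmf n) (fun c => ((kcm_inv R c - A n) / S n <= x)%R%:R)))//.
apply/funext => n.
by rewrite (wmean_inv k_gt0 n (fun i => ((i - A n) / S n <= x)%R%:R)).
Qed.

End kcm_clt.

Lemma standard_normal_cdf (R : realType) (d : measure_display)
    (T : measurableType d) (Q : probability T R) (Z : {RV Q >-> R}) :
  standard_normal Z -> cdf Z = fun y : R => (gauss_mean \1_`]-oo, y])%:E.
Proof.
by move=> ZN; apply/funext => y; rewrite gauss_mean_indic// -ZN.
Qed.

Theorem theorem2 (R : realType) (k : nat) (k_gt0 : (0 < k)%N)
    (d : measure_display) (T : measurableType d) (Q : probability T R)
    (Z : {RV Q >-> R}) (Z_normal : standard_normal Z) :
  cvg_in_distribution
    (fun n : nat => kcm_RV (fun c : draws n k =>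
       (kcm_inv R c - kcm_inv_mean R n k) / Num.sqrt (kcm_inv_var R n k)))
    Z
  /\
  cvg_in_distribution
    (fun n : nat => kcm_RV (fun c : draws n k =>
       (kcm_inv R c - kcm_a R k * n%:R ^+ 2)
         / (Num.sqrt (kcm_b R k) * n%:R `^ (3 / 2))))
    Z.
Proof.
have reduce (A S : nat -> R) :
    Num.sqrt (kcm_var k n) / S n @[n --> \oo] --> (1 : R) ->
    (kcm_mean k n - A n) / S n @[n --> \oo] --> (0 : R) ->
    cvg_in_distribution
      (fun n => kcm_RV (fun c : draws n k => (kcm_inv R c - A n) / S n)) Z.
  move=> cS cA x; rewrite (standard_normal_cdf Z_normal) => cx.
  rewrite (_ : (fun n => cdf _ x) = fun n => (wmean (@kcm_pmf n k R)
      (fun c => ((kcm_inv R c - A n) / S n <= x)%R%:R))%:E); last first.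
    by apply/funext => n; exact: kcm_cdf.
  apply: cvg_EFin; first exact: nearW.
  by apply: kcm_clt => //; exact: (fine_cvg cx).
split; apply: reduce.
- under eq_fun do rewrite kcm_inv_var_sum//.
  apply: cvg_near_cst; have := @kcm_var_gt0 R _ k_gt0.
  apply: filterS => n V0.
  by rewrite divff// gt_eqF// sqrtr_gt0.
- apply: cvg_near_cst; apply: nearW => n.
  by rewrite kcm_inv_mean_sum// subrr mul0r.
- exact: kcm_var_equiv.
- exact: kcm_mean_equiv.
Qed.
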